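(* Let $A$ be finite with $|A|\ge2$, let $Q$ and $H\subseteq A^Q$ be non-empty finite sets, and let $\mathcal F\subseteq\mathcal O(A)$ be a symmetric conservative clone with $\mathrm r(\mathcal F)=2$. Write $\mathrm R^*_2(\mathcal F)=\mathrm R_2(\mathcal F)\cap(A^2_2\times A^2_2)$. (4) If neither (i) $|A|=4$ and $\mathrm R^*_2(\mathcal F)=R_\pm(A)$, nor (ii) $|A|=3$ and $\mathrm R^*_2(\mathcal F)=R_\uparrow(A)$ holds, then $H\in\mathrm{Inv}_Q\mathcal F$ iff (a) $H|_{Q^{[B]}_H}\in\mathrm{Inv}_{Q^{[B]}_H}\mathcal F|_{B^{<\omega}}$ for all $B\in[A]^2$, and (b) $H$ is decomposable over $[Q]^1\cup[Q]^{2,id}_H\cup\{Q^{[B]}_H:B\in[A]^2\}$. (5) If $|A|=4$ and $\mathrm R^*_2(\mathcal F)=R_\pm(A)$, then $H\in\mathrm{Inv}_Q\mathcal F$ iff (a) $H|_P\in\mathrm{Inv}_P\mathcal F$ for all $P\in[Q]^{2,0}_H$, (b) $H|_{Q^{(3)}_H}$ is preserved by all Klein's $\Pi_0(\mathcal F)$-functions, and (c) $H$ is decomposable over $[Q]^1\cup[Q]^{2,0}_H\cup\{Q^{(3)}_H\}$. (6) If $|A|=3$ and $\mathrm R^*_2(\mathcal F)=R_\uparrow(A)$, then $H\in\mathrm{Inv}_Q\mathcal F$ iff (a) $H|_P\in\mathrm{Inv}_P\mathcal F$ for all $P\in[Q]^{2,0}_H\cup[Q]^{2,1}_H$, and (b)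 $H$ is decomposable over $[Q]^1\cup[Q]^{2,0}_H\cup[Q]^{2,1}_H$.
   Context: $\mathcal O(A)=\bigcup_{n<\omega}A^{A^n}$; $\mathcal F_{[n]}=\mathcal F\cap A^{A^n}$; $S_A$ the permutations of $A$; $[X]^k$ the $k$-element subsets of $X$; $A^2_2$ the pairs $\mathbf x=x_0x_1$ with $x_0\ne x_1$, $\mathrm{ran}\,\mathbf x=\{x_0,x_1\}$. A clone with carrier $A$ is a subset of $\mathcal O(A)$ containing all projections and closed under composition; conservative if $f(\mathbf a)\in\mathrm{ran}\,\mathbf a$ for all members $f$; symmetric if for each member $f$ and $\sigma\in S_A$, $f_\sigma(\mathbf a)=\sigma^{-1}(f(\sigma(\mathbf a)))$ is a member. $\mathrm r(\mathcal F)$ is the least $r$ such that $\mathcal F$ has a non-projection $r$-ary member. $\mathrm R_2(\mathcal F)$: $\mathbf a\,\mathrm R_2(\mathcal F)\,\mathbf b$ iff some $\sigma\in S_A$ satisfies $f(\mathbf b)=\sigma(f(\mathbf a))$ for all $f\in\mathcal F_{[2]}$. For $|A|=3$: $R_\uparrow(A)=\{(ab,cd)\in A^2_2\times A^2_2: ab=cd\ \text{or}\ (b=c\wedge a\ne d)\ \text{or}\ (a=d\wedge b\ne c)\}$. For $|A|=4$: $R_\pm(A)=\{(\mathbf x,\mathbf y)\in A^2_2\times A^2_2:\mathrm{ran}\,\mathbf x=\mathrm{ran}\,\mathbf y\ \text{or}\ \mathrm{ran}\,\mathbf x\cap\mathrm{ran}\,\mathbf y=\emptyset\}$. For symmetric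 conservative $\mathcal F$, $\Pi_0(\mathcal F)$ is the clone on $\{0,1\}$ equal to $\{\sigma\circ f|_{B^n}\circ\sigma^{-1}:n<\omega,f\in\mathcal F_{[n]}\}$ for any $B\in[A]^2$ and bijection $\sigma\colon B\to\{0,1\}$ (independent of the choices). For $|A|=4$ and a clone $P$ on $\{0,1\}$, $f\in\mathcal O(A)_{[n]}$ is a Klein's $P$-function if (1) for every $B\in[A]^2$, $f$ maps $B^n$ into $B$ and $\sigma\circ f|_{B^n}\circ\sigma^{-1}\in P$ for a bijection $\sigma\colon B\to\{0,1\}$, and (2) $\sigma(f(\mathbf a))=f(\sigma(\mathbf a))$ for all $\mathbf a\in A^n$ with exactly two distinct entries and all $\sigma$ in the Klein four-group of permutations of $A$ (identity and the three fixed-point-free involutions). For $B\subseteq A$, $\mathcal F|_{B^{<\omega}}=\{f|_{B^n}:f\in\mathcal F_{[n]}\}$. For $f\in\mathcal O(A)_{[m]}$, $h_i\in A^Q$, $f(h_0,\dots,h_{m-1})$ is $q\mapsto f(h_0(q)\dots h_{m-1}(q))$; $f$ preserves $H$ if $H$ is closed under such compositions; $\mathrm{Inv}_Q\mathcal F$ is the set of $H\subseteq A^Q$ preserved by all $f\in\mathcal F$. $H|_P=\{h|_P:h\in H\}$, $H(q)=\{h(q):h\in H\}$. $(H|_R)|^Q=\{f\in A^Q:f|_R\in H|_R\}$; $H$ is decomposable over $\mathscr R$ if $H=\bigcap_{R\in\mathscr R}(H|_R)|^Q$. $[Q]^{2,0}_H$: pairs $\{p,q\}$ with some $\sigma\in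 S_A$ such that $h(q)=\sigma(h(p))$ for all $h\in H$; $[Q]^{2,1}_H$: pairs $\{p,q\}$ with some $a,b\in A$ such that $h(p)=a$ or $h(q)=b$ for every $h\in H$; $[Q]^{2,id}_H$: pairs $\{p,q\}$ with $h(p)=h(q)$ for all $h\in H$; $Q^{(3)}_H=\{q:|H(q)|<3\}$; $Q^{[B]}_H=\{q:H(q)\subseteq B\}$. *)

(* Defs.v *)
From mathcomp Require Import all_boot all_order all_fingroup.
Set Implicit Arguments. Unset Strict Implicit. Unset Printing Implicit Defensive.

Section Defs.
Variable A : finType.

Definition op (n : nat) := {ffun {ffun 'I_n -> A} -> A}.
Definition bop (n : nat) := {ffun {ffun 'I_n -> bool} -> bool}.

Definition opset := forall n : nat, op n -> Prop.

Definition proj n (i : 'I_n) : op n := [ffun a : {ffun 'I_n -> A} => a i].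
Definition comp m n (f : op m) (g : 'I_m -> op n) : op n :=
  [ffun a : {ffun 'I_n -> A} => f [ffun i => g i a]].

Definition is_clone (F : opset) : Prop :=
  (forall n (i : 'I_n), F n (proj i)) /\
  (forall m n (f : op m) (g : 'I_m -> op n),
      F m f -> (forall i, F n (g i)) -> F n (comp f g)).

Definition conservative (F : opset) : Prop :=
  forall n (f : op n), F n f -> forall a, exists i, f a = a i.

Definition symmetric_clone (F : opset) : Prop :=
  forall n (f : op n), F n f -> forall s : {perm A},
    F n [ffun a : {ffun 'I_n -> A} => (s^-1)%g (f [ffun i => s (a i)])].

Definition is_proj n (f : op n) : Prop := exists i, f = proj i.

Definition r_is (F : opset) (r : nat) : Prop :=
  (exists f, F r f /\ ~ is_proj f) /\
  (forall k, k < r -> forall f : op k, F k f -> is_proj f).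

Definition x0 (x : {ffun 'I_2 -> A}) := x ord0.
Definition x1 (x : {ffun 'I_2 -> A}) := x ord_max.
Definition ranp (x : {ffun 'I_2 -> A}) : {set A} := [set x0 x; x1 x].

Definition R2 (F : opset) (a b : {ffun 'I_2 -> A}) : Prop :=
  exists s : {perm A}, forall f, F 2 f -> f b = s (f a).

Definition R2star (F : opset) (a b : {ffun 'I_2 -> A}) : Prop :=
  x0 a != x1 a /\ x0 b != x1 b /\ R2 F a b.

Definition Rup (x y : {ffun 'I_2 -> A}) : Prop :=
  x0 x != x1 x /\ x0 y != x1 y /\
  (x = y \/ (x1 x = x0 y /\ x0 x != x1 y) \/ (x0 x = x1 y /\ x1 x != x0 y)).

Definition Rpm (x y : {ffun 'I_2 -> A}) : Prop :=
  x0 x != x1 x /\ x0 y != x1 y /\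
  (ranp x = ranp y \/ ranp x :&: ranp y = set0).

Section Index.
Variable I : finType.

Definition pcomp n (f : op n) (hs : 'I_n -> {ffun I -> A}) : {ffun I -> A} :=
  [ffun q => f [ffun i => hs i q]].

Definition preserves n (f : op n) (K : {set {ffun I -> A}}) : Prop :=
  forall hs : 'I_n -> {ffun I -> A}, (forall i, hs i \in K) -> pcomp f hs \in K.

Definition Inv (F : opset) (K : {set {ffun I -> A}}) : Prop :=
  forall n (f : op n), F n f -> preserves f K.

(* K \in Inv_I (F|_{B^{<omega}}) : K is a set of B-valued functions, closed under
   the restrictions f|_{B^n} of members f of F *)
Definition InvB (B : {set A}) (F : opset) (K : {set {ffun I -> A}}) : Prop :=
  (forall k, k \in K -> forall q, k q \in B) /\
  (forall n (f : op n), F n f ->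
     forall hs : 'I_n -> {ffun I -> A}, (forall i, hs i \in K) ->
       (forall i q, hs i q \in B) -> pcomp f hs \in K).
End Index.

Section Q.
Variable Q : finType.

Definition subQ (P : {set Q}) := {q : Q | q \in P}.
Definition res (P : {set Q}) (h : {ffun Q -> A}) : {ffun subQ P -> A} :=
  [ffun q => h (val q)].
Definition resset (H : {set {ffun Q -> A}}) (P : {set Q}) : {set {ffun subQ P -> A}} :=
  [set res P h | h in H].

Definition decomposable (H : {set {ffun Q -> A}}) (fam : {set Q} -> Prop) : Prop :=
  forall g : {ffun Q -> A},
    g \in H <-> (forall R, fam R -> res R g \in resset H R).

Definition Hq (H : {set {ffun Q -> A}}) (q : Q) : {set A} := [set (h : {ffun Q -> A}) q | h in H].

Definition singles (R : {set Q}) : Prop := exists q, R = [set q].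
Definition pairs0 (H : {set {ffun Q -> A}}) (R : {set Q}) : Prop :=
  exists p q, p != q /\ R = [set p; q] /\
    exists s : {perm A}, forall h, h \in H -> h q = s (h p).
Definition pairs1 (H : {set {ffun Q -> A}}) (R : {set Q}) : Prop :=
  exists p q, p != q /\ R = [set p; q] /\
    exists a b : A, forall h, h \in H -> h p = a \/ h q = b.
Definition pairsid (H : {set {ffun Q -> A}}) (R : {set Q}) : Prop :=
  exists p q, p != q /\ R = [set p; q] /\ forall h, h \in H -> h p = h q.
Definition Q3 (H : {set {ffun Q -> A}}) : {set Q} := [set q | #|Hq H q| < 3].
Definition QB (H : {set {ffun Q -> A}}) (B : {set A}) : {set Q} :=
  [set q | Hq H q \subset B].
End Q.

(* sigma o f|_{B^n} o sigma^{-1} for B = {b0,b1}, sigma : b0 |-> 0, b1 |-> 1 *)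
Definition conj_op n (b0 b1 : A) (f : op n) : bop n :=
  [ffun x : {ffun 'I_n -> bool} => f [ffun i => if x i then b1 else b0] == b1].

(* Pi_0(F): union over all choices of B and sigma (independent of the choice) *)
Definition Pi0 (F : opset) : forall n, bop n -> Prop :=
  fun n g => exists f : op n, F n f /\
    exists b0 b1 : A, b0 != b1 /\ g = conj_op b0 b1 f.

Definition klein (s : {perm A}) : Prop :=
  s = 1%g \/ ((forall x, s x != x) /\ (forall x, s (s x) = x)).

Definition klein_fun (P : forall n, bop n -> Prop) n (f : op n) : Prop :=
  (forall b0 b1 : A, b0 != b1 ->
     (forall a : {ffun 'I_n -> A}, (forall i, a i \in [set b0; b1]) -> f a \in [set b0; b1]) /\
     (P n (conj_op b0 b1 f) \/ P n (conj_op b1 b0 f))) /\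
  (forall a : {ffun 'I_n -> A}, #|[set a i | i : 'I_n]| = 2 ->
     forall s : {perm A}, klein s -> s (f a) = f [ffun i => s (a i)]).

End Defs.

(* Main.v *)
Require Import Defs.
From mathcomp Require Import all_boot all_order all_fingroup.
From Stdlib Require Import Classical.
Set Implicit Arguments. Unset Strict Implicit. Unset Printing Implicit Defensive.

(** Record a member f of F_2 by the set of pairs (x, y) on which it selects y.  These sets form a
    lattice: f(x, g(x, y)) realizes the intersection and f(g(x, y), y) the union.  Since S_A acts
    transitively on the pairs, "selecting y at one pair forces it at another" is symmetric, hence
    F_2 consists of all conservative operations compatible with R_2(F).  An S_A-invariant
    equivalence on pairs relates only pairs with the same range, unless it is total, R_pm or R_up.

    Outside case R_up, let G be trivial (case 4) or the Klein group (case 5).  The binary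
    operations switching exactly on the G-orbit of one block {a, b} compose to a ternary operation
    switching exactly on the G-orbit of one triple (a, b, c) of distinct elements.  With it any
    member of F can be changed on a single G-orbit of tuples having at least three values, so F
    contains every conservative G-equivariant operation that is a projection on each B^n, |B| = 2.
    If g is locally in H = {h_1, ..., h_n}, then (h_1(q), ..., h_n(q)) |-> g(q) extends to such an
    operation, whence g is in H.

    In case R_up, F_2 contains both cyclic tournaments on A.  They generate a majority operation,
    so H is determined by its projections on pairs of indices, and a finite inspection of the
    subsets of a 3 x 3 grid closed under both tournaments identifies these projections. *)

(** * Binary members *)

(** A permutation correct on the tail is followed by the transposition of [p x] and [y], which fixes
    every point already placed. *)
Lemma uniq_perm_map (A : finType) (s t : seq A) :
  uniq s -> uniq t -> size s = size t -> exists p : {perm A}, map p s = t.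
Proof.
elim: s t => [|x s IH] [|y t] //=; first by exists 1%g.
move=> /andP[xs us] /andP[yt ut] [e]; have [p pst] := IH t us ut e.
exists (p * tperm (p x) y)%g; rewrite permM tpermL; congr (_ :: _).
rewrite -[RHS]pst; apply/eq_in_map => z zs; rewrite permM tpermD //.
  by rewrite (inj_eq perm_inj); apply: contraNneq xs => ->.
by apply: contraNneq yt => ->; rewrite -pst map_f.
Qed.

Section Binary.
Variable A : finType.

Definition pr (x y : A) : {ffun 'I_2 -> A} := [ffun i => if i == ord0 then x else y].
Definition ap2 (f : op A 2) (x y : A) : A := f (pr x y).

Lemma x0_pr x y : x0 (pr x y) = x. Proof. by rewrite /x0 ffunE eqxx. Qed.
Lemma x1_pr x y : x1 (pr x y) = y. Proof. by rewrite /x1 ffunE. Qed.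
Lemma pr_x (a : {ffun 'I_2 -> A}) : pr (x0 a) (x1 a) = a.
Proof.
apply/ffunP => i; rewrite ffunE; case: eqP => [->//|].
case: i => [[|[|?]]] // h; first by case; apply: val_inj.
by move=> _; congr (a _); apply: val_inj.
Qed.
Lemma ap2E (f : op A 2) a : ap2 f (x0 a) (x1 a) = f a. Proof. by rewrite /ap2 pr_x. Qed.
Lemma map_pr (s : A -> A) x y : [ffun i => s (pr x y i)] = pr (s x) (s y).
Proof. by apply/ffunP => i; rewrite !ffunE; case: eqP. Qed.

Definition mem_op (F : opset A) n (phi : {ffun 'I_n -> A} -> A) := F n (finfun phi).

Definition tr (x y z : A) : {ffun 'I_3 -> A} :=
  [ffun i : 'I_3 => if i == 0 :> nat then x else if i == 1 :> nat then y else z].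
Definition ap3 (f : op A 3) (x y z : A) : A := f (tr x y z).

Section Clone.
Variable F : opset A.
Hypothesis cF : is_clone F.

Lemma mem_ext n phi psi : phi =1 psi -> @mem_op F n phi -> mem_op F psi.
Proof. by move=> e; rewrite /mem_op (_ : finfun phi = finfun psi) //; apply/ffunP => t; rewrite !ffunE. Qed.

Lemma mem_self n (f : op A n) : F f -> mem_op F f.
Proof. by rewrite /mem_op (_ : finfun f = f) //; apply/ffunP => t; rewrite ffunE. Qed.

Lemma mem_var n (i : 'I_n) : mem_op F (fun t => t i).
Proof. exact: (proj1 cF). Qed.

Lemma mem_comp m n (f : op A m) (phi : 'I_m -> {ffun 'I_n -> A} -> A) :
  F f -> (forall i, mem_op F (phi i)) -> mem_op F (fun t => f [ffun i => phi i t]).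
Proof.
move=> Ff Fphi; have := proj2 cF m n f (fun i => finfun (phi i)) Ff Fphi.
apply: (@mem_ext n (fun t => f [ffun i => (finfun (phi i)) t])) => t.
by congr (f _); apply/ffunP => i; rewrite !ffunE.
Qed.

Lemma mem_ap2 n f (phi psi : {ffun 'I_n -> A} -> A) : F f ->
  mem_op F phi -> mem_op F psi -> mem_op F (fun t => ap2 f (phi t) (psi t)).
Proof.
move=> Ff F1 F2.
apply: (mem_ext _ (mem_comp (phi := fun i => if i == ord0 then phi else psi) Ff _)).
  by move=> t; congr (f _); apply/ffunP => i; rewrite !ffunE; case: ifP.
by move=> i; case: ifP.
Qed.

Lemma mem_ap3 n f (phi psi chi : {ffun 'I_n -> A} -> A) : F f ->
  mem_op F phi -> mem_op F psi -> mem_op F chi ->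
  mem_op F (fun t => ap3 f (phi t) (psi t) (chi t)).
Proof.
move=> Ff F1 F2 F3.
pose v (i : 'I_3) := if i == 0 :> nat then phi else if i == 1 :> nat then psi else chi.
apply: (mem_ext _ (mem_comp (phi := v) Ff _)).
  by move=> t; congr (f _); apply/ffunP => i; rewrite !ffunE /v; do 2?case: ifP.
by move=> i; rewrite /v; do 2?case: ifP.
Qed.

Hypothesis consF : conservative F.

Lemma ap2_cons f x y : F f -> ap2 f x y = x \/ ap2 f x y = y.
Proof. by move=> /consF /(_ (pr x y)) [i]; rewrite /ap2 => ->; rewrite ffunE; case: eqP; [left|right]. Qed.

Lemma ap2_xx f x : F f -> ap2 f x x = x.
Proof. by move=> /ap2_cons - /(_ x x) []. Qed.

(* Members of F_2 are encoded by the coordinate they select on each pair; R_2(F) identifies the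
   pairs on which all of them select the same coordinate. *)
Definition same (a b c d : A) := forall f, F f -> (ap2 f a b == b) = (ap2 f c d == d).

Lemma same_refl a b : same a b a b. Proof. by []. Qed.
Lemma same_sym a b c d : same a b c d -> same c d a b.
Proof. by move=> h f /h ->. Qed.
Lemma same_trans a b c d x y : same a b c d -> same c d x y -> same a b x y.
Proof. by move=> h k f Ff; rewrite h // k. Qed.

Lemma ap2_swap f : F f -> exists2 g, F g & forall x y, ap2 g x y = ap2 f y x.
Proof.
move=> Ff; exists [ffun t : {ffun 'I_2 -> A} => ap2 f (t ord_max) (t ord0)].
  by apply: mem_ap2 => //; apply: mem_var.
by move=> x y; rewrite {1}/ap2 ffunE !ffunE.
Qed.

Lemma same_rev a b c d : a != b -> c != d -> same a b c d -> same b a d c.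
Proof.
move=> ab cd h f Ff; have [g Fg gE] := ap2_swap Ff.
have := h g Fg; rewrite !gE.
have aux x y : x != y -> (ap2 f y x == y) = ~~ (ap2 f y x == x).
  by move=> xy; case: (ap2_cons y x Ff) => ->; rewrite eqxx ?(negPf xy) // eq_sym xy.
by rewrite !aux // => /negb_inj.
Qed.

(** Conservativity leaves two possible values, so any permutation carrying [x] to [y] is a witness;
    conversely the second projection forces a witness to carry [x1 x] to [x1 y]. *)
Lemma R2starP x y :
  R2star F x y <-> [/\ x0 x != x1 x, x0 y != x1 y & same (x0 x) (x1 x) (x0 y) (x1 y)].
Proof.
split=> [[nx [ny [s hs]]]|[nx ny h]].
  split=> // f Ff; rewrite !ap2E (hs f Ff).
  have /hs := proj1 cF 2 ord_max; rewrite !ffunE => e.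
  by rewrite [X in s _ == X]e (inj_eq perm_inj).
split=> //; split=> //.
have [||//|s [e0 e1]] := @uniq_perm_map A [:: x0 x; x1 x] [:: x0 y; x1 y].
- by rewrite /= inE nx.
- by rewrite /= inE ny.
exists s => f Ff; have := h f Ff; rewrite -!ap2E.
case: (ap2_cons (x0 x) (x1 x) Ff) => ->; case: (ap2_cons (x0 y) (x1 y) Ff) => -> //.
  by rewrite eqxx (negPf nx).
by rewrite eqxx (negPf ny).
Qed.

Hypothesis symF : symmetric_clone F.

Lemma ap2_perm (s : {perm A}) f : F f ->
  exists2 g, F g & forall x y, s (ap2 g x y) = ap2 f (s x) (s y).
Proof.
move=> /symF - /(_ s) Fg; eexists; first exact: Fg.
by move=> x y; rewrite {1}/ap2 ffunE permKV map_pr.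
Qed.

Lemma same_perm (s : {perm A}) a b c d :
  same a b c d -> same (s a) (s b) (s c) (s d).
Proof.
move=> h f /(ap2_perm s)[g Fg gE]; have := h g Fg.
by rewrite -!gE !(inj_eq perm_inj).
Qed.

(* "f selects the second entry of (a,b) only if it does so on (c,d)" is a preorder invariant
   under the transitive action of a finite group, hence symmetric. *)
Lemma separate a b c d : a != b -> c != d -> ~ same a b c d ->
  exists f, [/\ F f, ap2 f a b = b & ap2 f c d = c].
Proof.
move=> ab cd nh; apply: NNPP => no; apply: nh.
have imp f : F f -> ap2 f a b = b -> ap2 f c d = d.
  move=> Ff e; case: (ap2_cons c d Ff) => // e'.
  by case: no; exists f.
have [||//|s [e0 e1]] := @uniq_perm_map A [:: a; b] [:: c; d].
- by rewrite /= inE ab.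
- by rewrite /= inE cd.
have step f k : F f -> ap2 f ((s ^+ k)%g a) ((s ^+ k)%g b) = (s ^+ k)%g b ->
    ap2 f ((s ^+ k.+1)%g a) ((s ^+ k.+1)%g b) = (s ^+ k.+1)%g b.
  move=> Ff; have [g Fg gE] := ap2_perm (s ^+ k)%g Ff.
  rewrite -gE => /perm_inj /(imp g Fg) e.
  by rewrite expgS !permM e0 e1 -gE e.
move=> f Ff; apply/eqP/eqP => [|e]; first exact: imp.
have all k : ap2 f ((s ^+ k.+1)%g a) ((s ^+ k.+1)%g b) = (s ^+ k.+1)%g b.
  elim: k => [|k]; first by rewrite expg1 e0 e1.
  exact: step.
(* The exponent [#[s]] leads back to [(a, b)], closing the cycle of implications. *)
have := all (#[s]%g.-1); rewrite prednK ?order_gt0 // expg_order.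
by rewrite !perm1.
Qed.

Lemma ap2_and f g : F f -> F g ->
  exists2 k, F k & forall x y, ap2 k x y = ap2 f x (ap2 g x y).
Proof.
move=> Ff Fg; exists [ffun t : {ffun 'I_2 -> A} => ap2 f (t ord0) (ap2 g (t ord0) (t ord_max))].
  by do 2?[apply: mem_ap2 => //]; apply: mem_var.
by move=> x y; rewrite {1}/ap2 !ffunE.
Qed.

Lemma ap2_or f g : F f -> F g ->
  exists2 k, F k & forall x y, ap2 k x y = ap2 f (ap2 g x y) y.
Proof.
move=> Ff Fg; exists [ffun t : {ffun 'I_2 -> A} => ap2 f (ap2 g (t ord0) (t ord_max)) (t ord_max)].
  by do 2?[apply: mem_ap2 => //]; apply: mem_var.
by move=> x y; rewrite {1}/ap2 !ffunE.
Qed.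

(** For each pair in [S], intersecting separating members over all pairs outside [S] gives a member
    that switches at this pair and nowhere outside [S]; the union of these is the required
    operation. On the diagonal idempotence settles the matter. *)
Lemma binary_interpolation (S : A -> A -> bool) :
  (forall a b c d, a != b -> c != d -> same a b c d -> S a b -> S c d) ->
  exists2 f, F f & forall x y, ap2 f x y = if S x y then y else x.
Proof.
move=> clS.
have H1 a b (l : seq (A * A)) : a != b -> S a b -> exists f,
    [/\ F f, ap2 f a b = b &
      forall z, z \in l -> ~~ S z.1 z.2 -> ap2 f z.1 z.2 = z.1].
  move=> ab Sab; elim: l => [|[c d] l [g [Fg g1 g2]]].
    by exists (proj A ord_max); split=> //; [exact: mem_var | rewrite /ap2 !ffunE].
  have [cd|cd] := eqVneq c d.
    exists g; split=> // z; rewrite inE => /orP[/eqP->|]; last exact: g2.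
    by rewrite /= cd ap2_xx.
  case: (boolP (S c d)) => [Scd|Scd].
    exists g; split=> // z; rewrite inE => /orP[/eqP->|]; last exact: g2.
    by rewrite /= Scd.
  have [|f [Ff f1 f2]] := separate ab cd.
    by move=> /clS h; rewrite h in Scd.
  have [k Fk kE] := ap2_and Ff Fg.
  exists k; split=> //; first by rewrite kE g1.
  move=> z; rewrite inE kE => /orP[/eqP-> _|zl Sz] /=; last by rewrite g2 // ap2_xx.
  by case: (ap2_cons c d Fg) => ->; rewrite ?ap2_xx.
have H2 (l : seq (A * A)) : exists f, [/\ F f,
      forall z, z \in l -> S z.1 z.2 -> ap2 f z.1 z.2 = z.2 &
      forall x y, ~~ S x y -> ap2 f x y = x].
  elim: l => [|[a b] l [g [Fg g1 g2]]].
    by exists (proj A ord0); split=> //; [exact: mem_var | move=> x y; rewrite /ap2 !ffunE].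
  have [ab|ab] := eqVneq a b.
    exists g; split=> // z; rewrite inE => /orP[/eqP->|]; last exact: g1.
    by rewrite /= ab ap2_xx.
  case: (boolP (S a b)) => [Sab|Sab]; last first.
    exists g; split=> // z; rewrite inE => /orP[/eqP->|]; last exact: g1.
    by rewrite /= (negPf Sab).
  have [f [Ff f1 f2]] := H1 a b (enum {: A * A}) ab Sab.
  have [k Fk kE] := ap2_or Ff Fg.
  exists k; split=> // [z|x y nS]; last by rewrite kE g2 // (f2 (x, y)) // mem_enum.
  rewrite inE kE => /orP[/eqP-> _|zl Sz] /=; last by rewrite g1 // ap2_xx.
  by case: (ap2_cons a b Fg) => ->; rewrite ?ap2_xx.
have [f [Ff f1 f2]] := H2 (enum {: A * A}).
exists f => // x y; case: ifP => [Sxy|/negbT /f2 //].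
by rewrite (f1 (x, y)) // mem_enum.
Qed.

End Clone.
End Binary.

(** * Changing operations on a single orbit *)

Lemma set2_eq (T : finType) (x y u v : T) :
  u != v -> u \in [set x; y] -> v \in [set x; y] -> [set x; y] = [set u; v].
Proof.
rewrite !inE => uv /orP[] /eqP eu /orP[] /eqP ev; move: uv; rewrite eu ev ?eqxx // => _.
by rewrite setUC.
Qed.

Section Patch.
Variables (A : finType) (G : {group {perm A}}).

Definition tact n (s : {perm A}) (t : {ffun 'I_n -> A}) : {ffun 'I_n -> A} := [ffun i => s (t i)].
Definition eqv n (f : op A n) := forall s, s \in G -> forall t, f (tact s t) = s (f t).
Definition orb a b x y :=
  [exists s in G, ((x == s a) && (y == s b)) || ((x == s b) && (y == s a))].
Definition orb3 a b c x y z := [exists s in G, [&& x == s a, y == s b & z == s c]].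

(** Both the trivial group and the Klein four-group on four points satisfy these three
    conditions. *)
Hypothesis invG : forall s, s \in G -> forall x, s (s x) = x.
Hypothesis freeG : forall s x, s \in G -> s x = x -> s = 1%g.
Hypothesis trG : (forall s, s \in G -> s = 1%g) \/ (forall x y, exists2 s, s \in G & s x = y).

Lemma tactM n s s' (t : {ffun 'I_n -> A}) : tact s (tact s' t) = tact (s' * s)%g t.
Proof. by apply/ffunP => i; rewrite !ffunE permM. Qed.

Lemma tactK n s (t : {ffun 'I_n -> A}) : s \in G -> tact s (tact s t) = t.
Proof. by move=> sG; apply/ffunP => i; rewrite !ffunE invG. Qed.

Lemma orb_self a b : orb a b a b.
Proof. by apply/existsP; exists 1%g; rewrite group1 !perm1 !eqxx. Qed.

(** An involution taking [b] to [a] takes [a] to [b], and a member of [G] fixing [a] is the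
    identity; so [b] is the only partner of [a] in the orbit of the block. *)
Lemma orb_l a b y : orb a b a y = (y == b).
Proof.
apply/idP/eqP => [|->]; last exact: orb_self.
case/existsP=> s /andP[sG] /orP[] /andP[/eqP e1 /eqP e2].
  by have e := freeG sG (esym e1); rewrite e2 e perm1.
by rewrite e2 e1 invG.
Qed.

Lemma orb_sym a b x y : orb b a x y = orb a b x y.
Proof. by apply/eq_existsb => s; rewrite orbC. Qed.

Lemma orb_r a b y : orb a b b y = (y == a).
Proof. by rewrite -orb_sym orb_l. Qed.

Lemma orb3_l a b c y z : orb3 a b c a y z = (y == b) && (z == c).
Proof.
apply/existsP/andP => [[s /and4P[sG /eqP e /eqP-> /eqP->]]|[/eqP-> /eqP->]].
  by rewrite (freeG sG (esym e)) !perm1.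
by exists 1%g; rewrite group1 !perm1 !eqxx.
Qed.

Lemma orb3_act s a b c x y z : s \in G -> orb3 a b c (s x) (s y) (s z) = orb3 a b c x y z.
Proof.
have aux s' x' y' z' : s' \in G -> orb3 a b c x' y' z' -> orb3 a b c (s' x') (s' y') (s' z').
  move=> sG /existsP[r /and4P[rG /eqP-> /eqP-> /eqP->]].
  by apply/existsP; exists (r * s')%g; rewrite groupM // !permM !eqxx.
move=> sG; apply/idP/idP; last exact: aux.
by move=> /(aux s _ _ _ sG); rewrite !invG.
Qed.

Definition within n (a b : A) (t : {ffun 'I_n -> A}) := forall i, t i \in [set a; b].
Definition eqv2 n (f : op A n) := forall s, s \in G -> forall (a b : A) (t : {ffun 'I_n -> A}), a != b ->
  within a b t -> f (tact s t) = s (f t).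

(** The blocks are corrected one at a time. The block operation [p] passes from [f0] to the local
    solution [g] only where their values form a translate of {a, b}, and there equivariance makes
    [g] correct. *)
Lemma patch_pairs (K : opset A) : is_clone K -> conservative K ->
  (forall a b, a != b ->
    exists2 p, K 2 p & forall x y, ap2 p x y = if orb a b x y then y else x) ->
  forall n (f : op A n), 'I_n -> (forall m (g : op A m), K m g -> eqv2 g) -> eqv2 f ->
  (forall a b, a != b ->
    exists2 g, K n g & forall t, within a b t -> g t = f t) ->
  exists f0, K n f0 /\
    forall (a b : A) t, a != b -> within a b t -> f0 t = f t.
Proof.
move=> cK consK pK n f i0 eqK eqf locf.
suff step (l : seq (A * A)) : exists f0, K n f0 /\
    forall z t, z \in l -> z.1 != z.2 -> within z.1 z.2 t -> f0 t = f t.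
  have [f0 [Kf0 h]] := step (enum {: A * A}); exists f0; split=> // a b t.
  by apply: (h (a, b)); rewrite mem_enum.
elim: l => [|[a b] l [f0 [Kf0 f0E]]]; first by exists (proj A i0); split=> //; apply: (proj1 cK).
have [ab|ab] := eqVneq a b.
  exists f0; split=> // z t; rewrite inE => /orP[/eqP->|]; last exact: f0E.
  by rewrite /= ab eqxx.
have [p Kp pE] := pK a b ab; have [g Kg gE] := locf a b ab.
exists [ffun t => ap2 p (f0 t) (g t)]; split.
  exact: (mem_ap2 cK Kp (mem_self Kf0) (mem_self Kg)).
have val (h : op A n) t a' b' : K n h -> within a' b' t -> h t \in [set a'; b'].
  by move=> /consK/(_ t)[i ->].
move=> z t; rewrite inE ffunE pE => /orP[/eqP-> _ tz|zl nz tz] /=.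
  rewrite -gE //; have := val _ _ _ _ Kf0 tz; have := val _ _ _ _ Kg tz.
  by rewrite !inE => /orP[] /eqP -> /orP[] /eqP ->; rewrite ?orb_l ?orb_r ?eqxx // if_same.
rewrite (f0E z) //; case: ifP => // /existsP[s /andP[sG h]].
have := val _ _ _ _ Kf0 tz; have := val _ _ _ _ Kg tz; rewrite (f0E z) // => gz fz.
(* The distinct values [f t] and [g t] fill a translate of {a, b}, which is therefore the block of
   [z]; so [s] carries [t] back into {a, b}. *)
have tsab i : tact s t i \in [set a; b].
  have := tz i; rewrite ffunE.
  have -> : [set z.1; z.2] = [set s a; s b].
    case/orP: h fz gz => /andP[/eqP-> /eqP->] fz gz; last rewrite [in RHS]setUC;
      by apply: set2_eq => //; rewrite (inj_eq perm_inj) // eq_sym.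
  by rewrite !inE => /orP[] /eqP->; rewrite invG // eqxx ?orbT.
have := gE _ tsab; rewrite (eqK _ _ Kg _ sG _ _ _ nz tz) (eqf _ sG _ _ _ nz tz).
by move/perm_inj.
Qed.

Section Members.
Variable K : opset A.
Hypothesis cK : is_clone K.
Hypothesis consK : conservative K.
Hypothesis eqvK : forall n (f : op A n), K f -> eqv f.
Hypothesis pK : forall a b, a != b ->
  exists2 p, K p & forall x y, ap2 p x y = if orb a b x y then y else x.

Lemma act_tr s x y z : tact s (tr x y z) = tr (s x) (s y) (s z).
Proof. by apply/ffunP => i; rewrite !ffunE; do 2?case: ifP. Qed.

(* The witness is p_ab(x, p_bc(p_ac(x, z), y)), where p_ab switches to its second argument exactly
   on the G-orbit of the block {a, b}. *)
Lemma triple_op a b c : a != b -> b != c -> a != c ->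
  exists2 u, K u & forall x y z, ap3 u x y z = if orb3 a b c x y z then y else x.
Proof.
move=> ab bc ac.
have [p Kp pE] := pK ab; have [q Kq qE] := pK bc; have [r Kr rE] := pK ac.
pose o0 : 'I_3 := @Ordinal 3 0 isT; pose o1 : 'I_3 := @Ordinal 3 1 isT.
pose o2 : 'I_3 := @Ordinal 3 2 isT.
pose u : op A 3 :=
  [ffun t : {ffun 'I_3 -> A} => ap2 p (t o0) (ap2 q (ap2 r (t o0) (t o2)) (t o1))].
have Ku : K u by rewrite /u; do 3?[apply: (mem_ap2 cK) => //]; apply: (mem_var cK).
have uE x y z : ap3 u x y z = ap2 p x (ap2 q (ap2 r x z) y) by rewrite /ap3 !ffunE.
exists u => // x y z.
have ua y' z' : ap3 u a y' z' = if (y' == b) && (z' == c) then b else a.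
  rewrite uE pE orb_l rE orb_l qE.
  have [->|zc] := eqVneq z' c.
    by rewrite orb_r andbT; have [->|yb] := eqVneq y' b; rewrite ?eqxx // eq_sym (negPf bc).
  (* A translate of the block {b, c} may contain [a]; it then misses [b], so the outer [p] keeps
     [a]. *)
  rewrite andbF /=; case: (boolP (orb b c a y')) => [h|_]; last by rewrite (negPf ab).
  case: eqP => // yb; move: h ac; rewrite yb; case/existsP=> s /andP[sG] /orP[] /andP[/eqP e1 /eqP e2].
    by rewrite e1 e2 invG // eqxx.
  by rewrite e1 (freeG sG (esym e2)) perm1 eqxx.
have [[s sG ex]|nx] := classic (exists2 s, s \in G & x = s a).
  have -> : x = s a by [].
  rewrite -(invG sG y) -(invG sG z) orb3_act // orb3_l.
  rewrite /ap3 -act_tr (eqvK Ku) //; have := ua (s y) (s z); rewrite /ap3 => ->.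
  by case: ifP => // /andP[/eqP-> _].
have -> : orb3 a b c x y z = false.
  by apply/negbTE/negP => /existsP[s /and4P[sG /eqP e _ _]]; apply: nx; exists s.
have G1 : forall s, s \in G -> s = 1%g.
  by case: trG => // /(_ a x)[s sG e]; case: nx; exists s.
have orb1 a' b' x' y' : orb a' b' x' y' =
    ((x' == a') && (y' == b')) || ((x' == b') && (y' == a')).
  apply/existsP/idP => [[s /andP[/G1 ->]]|h]; first by rewrite !perm1.
  by exists 1%g; rewrite group1 !perm1.
have xa : x != a by apply/eqP => e; apply: nx; exists 1%g; rewrite ?group1 // perm1.
rewrite uE pE rE qE !orb1 (negPf xa) /=.
have [->|xb] /= := eqVneq x b; last by [].
rewrite (negPf bc) /= eqxx (negPf bc) /= orbF.
by have [->|_] := eqVneq y c; rewrite [_ == a]eq_sym ?(negPf ab) ?(negPf ac).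
Qed.

(** A third value [c] in [t] makes [triple_op] applicable. Only tuples in the orbit of [t] are
    changed, and there equivariance of [f] gives the right value, so no agreement with [f] is
    lost. *)
Lemma patch_orbit n (f f0 : op A n) t :
  eqv f -> K f0 -> (exists j, f t = t j) -> f t != f0 t ->
  (exists k, t k != f t /\ t k != f0 t) ->
  exists f1, [/\ K f1, f1 t = f t & forall t', f1 t' = f t' \/ f1 t' = f0 t'].
Proof.
move=> eqf Kf0 [j fj] ne [k [kb ka]].
set b := f t in fj ne kb *; set a := f0 t in ne ka *; set c := t k in ka kb.
have ab : a != b by rewrite eq_sym.
have ac : a != c by rewrite eq_sym.
have bc : b != c by rewrite eq_sym.
have cb : c != b by [].
have [u Ku uE] := triple_op ab bc ac.
have [u' Ku' uE'] := triple_op ac cb ab.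
pose away W := forall t', ~ (exists2 s, s \in G & f0 t' = s a) -> W t' = f0 t'.
have awayP x y z a' b' c' : ~ (exists2 s, s \in G & x = s a') -> orb3 a' b' c' x y z = false.
  by move=> h; apply/negbTE/negP => /existsP[s /and4P[sG /eqP e _ _]]; apply: h; exists s.
have shuffle (x y z w : bool) : [&& x, y, z & w] = [&& x, y & w] && z.
  by case: x y z w => [] [] [] [].
(* [W] equals [f0] except on the G-orbit of the tuples t' with f0 t' = a, t'_j = b, t'_k = c that
   agree with [t] on [l].  The next index i is tested by u_{a,b,t_i} if t_i is a third value; a
   coincidence of t_i with b or a is first moved to another value with the help of c. *)
have step (l : seq 'I_n) : exists W : op A n, [/\ K W, away W & forall t', f0 t' = a ->
    W t' = if [&& t' j == b, t' k == c & all (fun i => t' i == t i) l] then b else a].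
  elim: l => [|i l [W [KW aW WE]]].
    exists [ffun t' => ap3 u (f0 t') (t' j) (t' k)]; split.
    - exact: (mem_ap3 cK Ku (mem_self Kf0) (mem_var cK j) (mem_var cK k)).
    - by move=> t' h; rewrite ffunE uE awayP.
    - by move=> t' e; rewrite ffunE uE e orb3_l andbT; case: ifP => // /andP[/eqP].
  have [ib|ib] := eqVneq (t i) b.
    exists [ffun t' => ap3 u (f0 t') (t' i) (ap3 u' (f0 t') (t' k) (W t'))]; split.
    - apply: (mem_ap3 cK Ku (mem_self Kf0) (mem_var cK i)).
      exact: (mem_ap3 cK Ku' (mem_self Kf0) (mem_var cK k) (mem_self KW)).
    - by move=> t' h; rewrite ffunE uE awayP.
    - move=> t' e; rewrite ffunE uE uE' e !orb3_l WE //= ib.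
      case: (t' i =P b) => [->|_] /=; last by rewrite !andbF.
      case: (t' k =P c) => [->|_] /=; last by rewrite andbF (negPf ac).
      by case: (_ && all _ _); rewrite ?eqxx ?(negPf ab) ?(negPf ac).
  have [ia|ia] := eqVneq (t i) a.
    (* Both inner calls switch under the same condition, passing on [W t'] and [t' k]; if these are
       [b] and [c], freeness of [G] gives [t' i = a]. Without the switch both return [t' i], which
       is not [b] and [c] at once. *)
    exists [ffun t' => ap3 u (f0 t') (ap3 u (t' i) (W t') (t' k)) (ap3 u' (t' i) (t' k) (W t'))].
    split.
    - apply: (mem_ap3 cK Ku (mem_self Kf0)).
        exact: (mem_ap3 cK Ku (mem_var cK i) (mem_self KW) (mem_var cK k)).
      exact: (mem_ap3 cK Ku' (mem_var cK i) (mem_var cK k) (mem_self KW)).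
    - by move=> t' h; rewrite ffunE uE awayP.
    - move=> t' e; rewrite ffunE uE uE uE' e orb3_l /= ia.
      have -> : orb3 a c b (t' i) (t' k) (W t') = orb3 a b c (t' i) (W t') (t' k).
        by apply: eq_existsb => s; rewrite [X in _ && (_ && X)]andbC.
      rewrite WE //; set l' := all _ l.
      rewrite shuffle.
      case: (boolP [&& t' j == b, t' k == c & l']) => [/and3P[_ /eqP -> _]|_].
        have -> : orb3 a b c (t' i) b c = (t' i == a).
          apply/existsP/eqP => [[s /and4P[sG /eqP-> /eqP e2 _]]|->].
            by rewrite (freeG sG (esym e2)) perm1.
          by exists 1%g; rewrite group1 !perm1 !eqxx.
        case: (t' i =P a) => [_|ne']; rewrite ?eqxx //=.
        by case: (t' i =P b) => [->|//]; rewrite (negPf bc).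
      by case: (orb3 _ _ _ _ _ _); rewrite ?(negPf ab) //; case: (t' i =P b) => [->|//]; rewrite (negPf bc).
  have [||v Kv vE] := @triple_op a b (t i) ab; try by rewrite eq_sym.
  exists [ffun t' => ap3 v (f0 t') (W t') (t' i)]; split.
  - exact: (mem_ap3 cK Kv (mem_self Kf0) (mem_self KW) (mem_var cK i)).
  - by move=> t' h; rewrite ffunE vE awayP.
  - move=> t' e; rewrite ffunE vE e orb3_l WE //=.
    by rewrite shuffle; case: [&& _, _ & _] => /=; rewrite ?eqxx ?(negPf ab).
have [W [KW aW WE]] := step (enum 'I_n).
have conv t' s : s \in G -> f0 t' = s a -> f0 (tact s t') = a.
  by move=> sG e; rewrite (eqvK Kf0) // e invG.
exists W; split=> //.
  rewrite WE // -fj /c !eqxx /=; case: ifP => // /negbT /allPn[i _]; by rewrite eqxx.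
(* A tuple with [f0]-value [s a] is replaced by its translate with value [a]; passing the test at
   all indices then means that this translate is [t]. *)
move=> t'; case: (classic (exists2 s, s \in G & f0 t' = s a)) => [[s sG e]|/aW]; last by right.
have e' := conv _ _ sG e.
move: e' {e}; rewrite -{2 3 4 5}[t'](tactK _ sG); move: (tact s t') => t2 e.
rewrite (eqvK KW) // (eqvK Kf0) // eqf //.
rewrite WE // e; case: ifP => [/and3P[_ _ /allP h]|_]; last by right.
left; congr (s _); rewrite /b; congr (f _); apply/ffunP => i; apply/esym/eqP.
by rewrite h // mem_enum.
Qed.

(** With projections as local solutions, [patch_pairs] yields a start that is correct on all tuples
    with at most two values; each use of [patch_orbit] then lowers the number of tuples of
    disagreement. *)
Lemma patch_all n (f : op A n) : 'I_n -> (forall t, exists i, f t = t i) -> eqv f ->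
  (forall a b, a != b -> exists j, forall t, within a b t -> f t = t j) ->
  K f.
Proof.
move=> i0 consf eqf prf.
have [|||f0 [Kf0 f0E]] := @patch_pairs K cK consK pK n f i0.
- by move=> m g Kg s sG a b t _ _; apply: eqvK.
- by move=> s sG a b t _ _; apply: eqf.
- move=> a b /prf[j h]; exists (proj A j); first exact: (proj1 cK).
  by move=> t /h ->; rewrite ffunE.
have [m] := ubnP #|[set t | f0 t != f t]|.
elim: m f0 Kf0 f0E => // m IH f0 Kf0 f0E.
have [e0 _|[t]] := set_0Vmem [set t | f0 t != f t].
  rewrite (_ : f = f0) //; apply/ffunP => t; apply/eqP/negPn/negP => h.
  by have := in_set0 t; rewrite -e0 inE eq_sym h.
rewrite inE => ne lt.
have [||f1 [Kf1 f1t f1E]] := patch_orbit eqf Kf0 (consf t); first by rewrite eq_sym.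
  (* Without a third value [t] would lie in the block of [f0 t] and [f t], where agreement already
     holds. *)
  apply: NNPP => no; move/eqP: (ne); apply.
  apply: (f0E (f0 t) (f t)) => // i.
  rewrite !inE; case: eqP => //= h1; case: eqP => //= h2.
  by case: no; exists i; split; apply/eqP.
apply: (IH f1) => // [a b t' ab h|].
  by case: (f1E t') => // ->; apply: f0E h.
rewrite ltnS in lt; apply: leq_trans lt; apply: proper_card; apply/properP; split.
  by apply/subsetP => t'; rewrite !inE; case: (f1E t') => // ->; rewrite ?eqxx.
by exists t; rewrite inE ?f1t ?eqxx.
Qed.

End Members.
End Patch.

(** * Interpolation by members of the clone *)

Section Realize.
Variables (A : finType) (G : {group {perm A}}).
Hypothesis invG : forall s, s \in G -> forall x, s (s x) = x.
Hypothesis freeG : forall s x, s \in G -> s x = x -> s = 1%g.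
Hypothesis trG : (forall s, s \in G -> s = 1%g) \/ (forall x y, exists2 s, s \in G & s x = y).
Variable F : opset A.
Hypothesis cF : is_clone F.
Hypothesis consF : conservative F.
Hypothesis symF : symmetric_clone F.
(** These two hypotheses place [R_2(F)] on distinct pairs between the orbit relation on ordered
    pairs and the one on blocks. *)
Hypothesis same_G : forall s a b, s \in G -> a != b -> same F a b (s a) (s b).
Hypothesis same_orb : forall a b x y, a != b -> x != y -> same F a b x y -> orb G a b x y.

Lemma orb_act s a b x y : s \in G -> orb G a b (s x) (s y) -> orb G a b x y.
Proof.
move=> sG /existsP[r /andP[rG h]]; apply/existsP; exists (r * s)%g.
rewrite groupM //= !permM.
by case/orP: h => /andP[/eqP <- /eqP <-]; rewrite !invG // !eqxx ?orbT.
Qed.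

Lemma orb_swap a b x y : orb G a b y x = orb G a b x y.
Proof. by apply/eq_existsb => s; congr (_ && _); rewrite andbC orbC andbC [X in _ || X]andbC. Qed.

Lemma block_op a b : a != b ->
  exists2 p, F p & forall x y, ap2 p x y = if orb G a b x y then y else x.
Proof.
move=> ab; apply: (binary_interpolation cF consF symF) => c d x y cd xy cdxy.
case/existsP=> s /andP[sG h]; apply: (orb_act sG).
have sxy : s x != s y by rewrite (inj_eq perm_inj).
have := same_perm symF s cdxy; case/orP: h => /andP[/eqP-> /eqP->]; rewrite !invG //.
  exact: same_orb.
move=> /(same_rev cF consF) h; rewrite -orb_swap; apply: same_orb => //; first by rewrite eq_sym.
by apply: h; rewrite // eq_sym.
Qed.

(** On a tuple over {a, b} the operation [f] acts as the binary member [g] obtained by identifying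
    arguments with equal entries, so [same_G] applies. *)
Lemma eqv2_mem n (f : op A n) : F f -> eqv2 G f.
Proof.
move=> Ff s sG a b t ab tab.
pose g : op A 2 :=
  [ffun w : {ffun 'I_2 -> A} => f [ffun i => w (if t i == a then ord0 else ord_max)]].
have Fg : F g.
  exact: (mem_comp (phi := fun i (w : {ffun 'I_2 -> A}) => w (if t i == a then ord0 else ord_max)) cF Ff
    (fun i => mem_var cF _)).
have g1 : ap2 g a b = f t.
  rewrite /ap2 ffunE; congr (f _); apply/ffunP => i; rewrite !ffunE.
  by have := tab i; rewrite !inE; case: (t i =P a) => [-> //|_ /eqP ->].
have g2 : ap2 g (s a) (s b) = f (tact s t).
  rewrite /ap2 ffunE; congr (f _); apply/ffunP => i; rewrite !ffunE.
  by have := tab i; rewrite !inE; case: (t i =P a) => [-> //|_ /eqP ->].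
have := same_G sG ab Fg; rewrite -g1 -g2.
case: (ap2_cons consF a b Fg) => ->; case: (ap2_cons consF (s a) (s b) Fg) => -> //.
  by rewrite eqxx (negPf ab).
by rewrite eqxx (inj_eq perm_inj) (negPf ab).
Qed.

Lemma block_patching n (f : op A n) : eqv2 G f ->
  (forall a b, a != b -> exists2 g, F g & forall t, within a b t -> g t = f t) ->
  (exists a b : A, a != b) ->
  exists f0, F f0 /\ forall a b t, a != b -> within a b t -> f0 t = f t.
Proof.
move=> eqf locf [a [b ab]].
have [g Fg _] := locf a b ab; have [i _] := consF Fg [ffun=> a].
by apply: (patch_pairs invG freeG cF consF block_op i) => // m h; apply: eqv2_mem.
Qed.

Lemma interpolation n (f : op A n) : 'I_n -> (forall t, exists i, f t = t i) -> eqv G f ->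
  (forall a b, a != b -> exists j, forall t, within a b t -> f t = t j) -> F f.
Proof.
(* [triple_op] requires equivariance on all tuples, while [eqv2_mem] gives it only on those with at
   most two values. The equivariant members form a clone that still contains the block
   operations. *)
pose K : opset A := fun n f => F f /\ eqv G f.
have actE m s (t : {ffun 'I_m -> A}) i : tact s t i = s (t i) by rewrite ffunE.
have cK : is_clone K.
  split=> [m i|m k h g [Fh eh] gK].
    by split; [exact: (proj1 cF) | move=> s sG t; rewrite !ffunE].
  split; first by apply: (proj2 cF) => // i; apply: (proj1 (gK i)).
  move=> s sG t; rewrite !ffunE -eh //; congr (h _); apply/ffunP => i.
  by rewrite !ffunE (proj2 (gK i)).
have consK : conservative K by move=> m h [/consF].
have eqK m (h : op A m) : K m h -> eqv G h by case.
move=> i0 consf eqf prf.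
suff [] : K n f by [].
apply: (patch_all invG freeG trG cK consK eqK _ i0) => //.
move=> a b ab; have [p Fp pE] := block_op ab; exists p => //; split=> // s sG t.
rewrite -[t]pr_x /tact map_pr.
rewrite -![p (pr _ _)]/(ap2 _ _ _) !pE.
have -> : orb G a b (s (x0 t)) (s (x1 t)) = orb G a b (x0 t) (x1 t).
  by apply/idP/idP => h; [|rewrite -[x0 t](invG sG) -[x1 t](invG sG) in h]; apply: orb_act h.
by case: ifP.
Qed.

Section Index.
Variables (Q : finType) (H : {set {ffun Q -> A}}) (g : {ffun Q -> A}).
(** [J B] names the coordinate selected on tuples over the block [B]; its invariance under [G] keeps
    the resulting operation equivariant. *)
Variable J : {set A} -> {ffun Q -> A}.
Hypothesis invH : Inv F H.
Hypothesis JH : forall B, J B \in H.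
Hypothesis Jg : forall a b q, a != b -> q \in QB H [set a; b] -> J [set a; b] q = g q.
Hypothesis JG : forall s a b, s \in G -> J [set s a; s b] = J [set a; b].
Hypothesis gH : forall q, exists2 h, h \in H & h q = g q.
Hypothesis gG : forall p q s, s \in G ->
  (forall h : {ffun Q -> A}, h \in H -> h q = s (h p)) -> g q = s (g p).

(* The rows [tq q] list the values at [q] of all members of [H], so [g = f(H)] as soon as
   [f] sends each row [tq q] to [g q]. *)
Lemma mem_of_local : g \in H.
Proof.
pose idx h := enum_rank_in (JH set0) h.
pose tq q : {ffun 'I_#|H| -> A} := [ffun i => (enum_val i : {ffun Q -> A}) q].
have tqI h q : h \in H -> tq q (idx h) = h q by move=> hH; rewrite ffunE enum_rankK_in.
have tqJ B q : tq q (idx (J B)) = J B q by apply: tqI.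
(* The value is prescribed on tuples over a block and on translates of rows, and defaults to the
   coordinate of [J set0] elsewhere. The last clause makes it unique, and uniqueness turns the
   invariance of [spec] into equivariance of [f]. *)
pose spec (t : {ffun 'I_#|H| -> A}) v :=
  [/\ forall a b, a != b -> within a b t -> v = t (idx (J [set a; b])),
      forall s q, s \in G -> t = tact s (tq q) -> v = s (g q) &
      (exists a b, a != b /\ within a b t) \/ (exists s q, s \in G /\ t = tact s (tq q)) \/
        v = t (idx (J set0))].
have QBP a b q : within a b (tq q) -> q \in QB H [set a; b].
  move=> w; rewrite inE; apply/subsetP => x /imsetP[h hH ->].
  by rewrite -(tqI h q hH); apply: w.
have within_act (s : {perm A}) a b (t : {ffun 'I_#|H| -> A}) : within a b t -> within (s a) (s b) (tact s t).
  by move=> w i; have := w i; rewrite ffunE !inE !(inj_eq perm_inj).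
have ex t : exists v, spec t v.
  have [[a [b [ab w]]]|nw] := classic (exists a b, a != b /\ within a b t).
    exists (t (idx (J [set a; b]))); split; last by left; exists a, b.
      move=> a' b' ab' w'.
      have [[i [j ij]]|no] := classic (exists i j, t i != t j).
        by rewrite (set2_eq ij (w i) (w j)) (set2_eq ij (w' i) (w' j)).
      by apply/eqP/negPn/negP => ne; apply: no; eexists; eexists; exact: ne.
    move=> s q sG e; rewrite e ffunE tqJ; congr (s _); rewrite -(JG _ _ sG); apply: Jg.
      by rewrite (inj_eq perm_inj).
    by apply: QBP; rewrite -[tq q](tactK invG _ sG) -e; apply: within_act.
  have [[s [q [sG e]]]|nq] := classic (exists s q, s \in G /\ t = tact s (tq q)).
    exists (s (g q)); split.
    - by move=> a b ab w; case: nw; exists a, b.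
    - move=> s' q' sG' e'.
      (* Since the rows of [q] and [q'] are translates, one member of [G] relates the values of
         every [h] in [H] at these indices. *)
      have -> : g q' = (s * s')%g (g q); last by rewrite permM invG.
      apply: gG => [|h hH]; first by rewrite groupM.
      rewrite permM -!tqI //.
      have := congr1 (fun u : {ffun _ -> _} => s' (u (idx h))) e.
      by rewrite /= e' !ffunE invG.
    - by right; left; exists s, q.
  exists (t (idx (J set0))); split; last by right; right.
  - by move=> a b ab w; case: nw; exists a, b.
  - by move=> s q sG e; case: nq; exists s, q.
have uni t v v' : spec t v -> spec t v' -> v = v'.
  move=> [s1 s2 s3] [s1' s2' s3'].
  case: s3 => [[a [b [ab w]]]|[[s [q [sG e]]]|e]]; first by rewrite (s1 a b) // (s1' a b).
    by rewrite (s2 s q) // (s2' s q).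
  case: s3' => [[a [b [ab w]]]|[[s [q [sG e']]]|e']]; first by rewrite (s1 a b) // (s1' a b).
    by rewrite (s2 s q) // (s2' s q).
  by rewrite e e'.
have spec_act s t v : s \in G -> spec t v -> spec (tact s t) (s v).
  move=> sG [s1 s2 s3]; split.
  - move=> a b ab w; rewrite ffunE; congr (s _).
    rewrite -(JG a b sG); apply: s1; first by rewrite (inj_eq perm_inj).
    by rewrite -[t](tactK invG _ sG); apply: within_act.
  - move=> s' q sG' e; rewrite (s2 (s' * s)%g q) ?groupM // ?permM ?invG //.
    by rewrite -tactM -e (tactK invG).
  - case: s3 => [[a [b [ab w]]]|[[s' [q [sG' e]]]|e]].
    + by left; exists (s a), (s b); rewrite (inj_eq perm_inj); split=> //; apply: within_act.
    + by right; left; exists (s' * s)%g, q; rewrite groupM // e tactM.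
    + by right; right; rewrite ffunE e.
have [f fP] := fin_all_exists ex.
have Ff : F [ffun t => f t].
  apply: interpolation.
  - exact: (idx (J set0)).
  - move=> t; rewrite ffunE; have [s1 s2 s3] := fP t.
    case: s3 => [[a [b [ab w]]]|[[s [q [sG e]]]|e]].
    + by exists (idx (J [set a; b])); apply: s1.
    + by have [h hH hq] := gH q; exists (idx h); rewrite (s2 s q) // e ffunE tqI // hq.
    + by eexists; exact: e.
  - by move=> s sG t; rewrite !ffunE; apply: (uni (tact s t)) => //; apply: spec_act.
  - by move=> a b ab; exists (idx (J [set a; b])) => t w; rewrite ffunE; have [s1 _ _] := fP t; apply: s1.
rewrite (_ : g = Defs.pcomp [ffun t => f t] (fun i : 'I_#|H| => enum_val i)).
  by apply: invH => // i; apply: enum_valP.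
apply/ffunP => q; rewrite !ffunE; have [_ s2 _] := fP (tq q).
by rewrite -(perm1 (g q)); apply/esym/s2; rewrite ?group1 //; apply/ffunP => i; rewrite !ffunE perm1.
Qed.

End Index.
End Realize.

(** * Classification of the relation R_2 *)

Lemma exists_fresh (A : finType) (s : seq A) : uniq s -> #|A| != size s ->
  size s <= #|A| -> exists e, e \notin s.
Proof.
move=> us; rewrite -(card_uniqP us) => ne le.
apply/existsP; rewrite -negb_forall; apply: contra ne => /forallP h.
by rewrite eq_sym; apply/eqP/eq_card => x; rewrite h.
Qed.

Lemma uniq_size_le (A : finType) (s : seq A) : uniq s -> size s <= #|A|.
Proof. by move=> /card_uniqP <-; apply: max_card. Qed.

Lemma uniq_full (A : finType) (s : seq A) x : uniq s -> #|A| = size s -> x \in s.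
Proof.
move=> us e; have := subset_leqif_card (subset_predT (mem s)).
move=> [_]; rewrite (card_uniqP us) -e eqxx => /esym /subsetP; exact.
Qed.

Section Classification.
Variables (A : finType) (F : opset A).
Hypothesis cF : is_clone F.
Hypothesis consF : conservative F.
Hypothesis symF : symmetric_clone F.

Lemma nonproj_separates : (exists f, F f /\ ~ is_proj (n := 2) f) ->
  exists a b c d, [/\ a != b, c != d & ~ same F a b c d].
Proof.
move=> [f [Ff np]]; apply: NNPP => no; apply: np.
have all a b c d : a != b -> c != d -> same F a b c d.
  by move=> ab cd; apply: NNPP => h; apply: no; exists a, b, c, d.
have [[a [b [ab e]]]|nx] := classic (exists a b, a != b /\ ap2 f a b = b).
  exists ord_max; apply/ffunP => t; rewrite ffunE -ap2E.
  have [->|ne] := eqVneq (x0 t) (x1 t); first exact: (ap2_xx consF _ Ff).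
  by apply/eqP; rewrite -(all a b _ _ ab ne f Ff) e eqxx.
exists ord0; apply/ffunP => t; rewrite ffunE -ap2E.
have [e|ne] := eqVneq (x0 t) (x1 t); first by rewrite -e (ap2_xx consF _ Ff).
by case: (ap2_cons consF (x0 t) (x1 t) Ff) => // e; case: nx; exists (x0 t), (x1 t).
Qed.

(** Transitivity on triples spreads the relation to all pairs with a common first entry, and
    reversal to those with a common second entry; such moves connect any two pairs. *)
Lemma same_shared_total a b c : uniq [:: a; b; c] -> same F a b a c ->
  forall x y z w, x != y -> z != w -> same F x y z w.
Proof.
move=> u h.
have S2 x y w : x != y -> x != w -> same F x y x w.
  move=> xy xw; have [->|yw] := eqVneq y w; first exact: same_refl.
  have v : uniq [:: x; y; w] by rewrite /= !inE negb_or xy xw yw.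
  have [p [pa pb pc]] := uniq_perm_map u v erefl.
  by have := same_perm symF p h; rewrite pa pb pc.
have S1 x y z : x != y -> z != y -> same F x y z y.
  by move=> xy zy; apply: (same_rev cF consF); rewrite 1?eq_sym //; apply: S2; rewrite eq_sym.
move=> x y z w xy zw.
have [wx|wx] := eqVneq w x; last first.
  by apply: (@same_trans _ _ _ _ x w); [apply: S2|apply: S1]; rewrite // eq_sym.
move: zw; rewrite wx => zx.
have [zy|zy] := eqVneq z y; last first.
  by apply: (@same_trans _ _ _ _ z y); [apply: S1|apply: S2].
rewrite zy.
have [e ex ey] : exists2 e, e != x & e != y.
  have le3 := uniq_size_le u.
  have u2 : uniq [:: x; y] by rewrite /= inE xy.
  have n2 : #|A| != 2 by rewrite neq_ltn le3 orbT.
  have [e] := exists_fresh u2 n2 (ltnW le3).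
  by rewrite !inE negb_or => /andP[]; exists e.
(* The reversed pair is reached along [(x, y)], [(x, e)], [(y, e)], [(y, x)]. *)
apply: (@same_trans _ _ _ _ x e); first by apply: S2; rewrite // eq_sym.
apply: (@same_trans _ _ _ _ y e); first by apply: S1; rewrite // eq_sym.
by apply: S2; rewrite eq_sym // eq_sym.
Qed.

Section Shared.
Hypothesis np : exists f, F f /\ ~ is_proj (n := 2) f.

Lemma not_shared a b c : uniq [:: a; b; c] -> ~ same F a b a c.
Proof.
move=> u h; have [x [y [z [w [xy zw]]]]] := nonproj_separates np.
by apply; apply: same_shared_total h _ _ _ _ xy zw.
Qed.

Lemma not_shared_r a b c : uniq [:: a; b; c] -> ~ same F b a c a.
Proof.
move=> u h; apply: (not_shared u); apply: (same_rev cF consF) => //; move: u;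
  by rewrite /= !inE negb_or !andbT => /andP[/andP[ab ac] _]; rewrite eq_sym.
Qed.

(** A fourth element [e] could replace [d] by symmetry; then [(b, d)] and [(b, e)] would be related,
    contrary to [not_shared]. *)
Lemma chain_card3 a b d : uniq [:: a; b; d] -> same F a b b d -> #|A| = 3.
Proof.
move=> u h; apply/eqP/negPn/negP => n3.
have [e eu] := exists_fresh u n3 (uniq_size_le u).
have v : uniq [:: a; b; e].
  by move: u eu; rewrite /= !inE !negb_or !andbT => /andP[/andP[-> _] _] /and3P[]; rewrite !(eq_sym e) => -> ->.
have [p [pa pb pd]] := uniq_perm_map u v erefl.
have := same_perm symF p h; rewrite pa pb pd => h'.
have w : uniq [:: b; d; e].
  by move: u eu; rewrite /= !inE !negb_or !andbT => /andP[_ ->] /and3P[_]; rewrite !(eq_sym e) => -> ->.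
apply: (not_shared w); apply: same_trans h'; exact: same_sym.
Qed.

Definition caseI := #|A| = 4 /\ (forall x y, R2star F x y <-> Rpm x y).
Definition caseII := #|A| = 3 /\ (forall x y, R2star F x y <-> Rup x y).

Lemma chain_caseII a b d : uniq [:: a; b; d] -> same F a b b d -> caseII.
Proof.
move=> u h; have c3 := chain_card3 u h; split=> // x y.
have mv p q r : uniq [:: p; q; r] -> same F p q q r.
  move=> v; have [s [sa sb sd]] := uniq_perm_map u v erefl.
  by have := same_perm symF s h; rewrite sa sb sd.
have tri (p q r : A) : p != q -> q != r -> p != r -> uniq [:: p; q; r].
  by rewrite /= !inE negb_or => -> -> ->.
rewrite R2starP // /Rup.
move: (x0 x) (x1 x) (x0 y) (x1 y) (pr_x x) (pr_x y) => p q r s ex ey.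
split=> [[pq rs k]|[pq [rs k]]]; last first.
  split=> //; case: k => [e|[[e1 e2]|[e1 e2]]].
  - have e0 : p = r by rewrite -[LHS](x0_pr p q) ex e -ey x0_pr.
    have e1 : q = s by rewrite -[LHS](x1_pr p q) ex e -ey x1_pr.
    by rewrite e0 e1.
  - by rewrite -e1; apply/mv/tri; rewrite // e1.
  - by rewrite e1; apply/same_sym/mv/tri; rewrite // -?e1 // eq_sym.
split=> //; split=> //.
have [epr|npr] := eqVneq p r.
  have [eqs|nqs] := eqVneq q s; first by left; rewrite -ex -ey epr eqs.
  by move: k; rewrite -epr => /not_shared []; apply: tri; rewrite // epr.
have [eqs|nqs] := eqVneq q s.
  by move: k; rewrite -eqs => /not_shared_r []; apply: tri => //; rewrite eq_sym // eqs.
(* As [(p, q)] is related to [(q, e)], a relation to [(q, p)] would join two pairs with first entry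
   [q]. *)
have nrev e : uniq [:: p; q; e] -> ~ same F p q q p.
  move=> v k'; have w : uniq [:: q; p; e].
    by move: v; rewrite /= !inE !negb_or !andbT (eq_sym q p) => /andP[/andP[-> ->] ->].
  apply: (not_shared w); apply: same_trans (mv _ _ _ v); exact: same_sym.
have [e v] : exists e, uniq [:: p; q; e].
  have u2 : uniq [:: p; q] by rewrite /= inE pq.
  have [||e] := exists_fresh u2; rewrite ?c3 //.
  by rewrite !inE negb_or => /andP[ep eq]; exists e; rewrite /= !inE negb_or pq !(eq_sym _ e) ep eq.
have [eqr|nqr] := eqVneq q r.
  right; left; split=> //; apply/eqP => eps.
  by move: k; rewrite -eqr -eps; apply: nrev v.
have [eps|nps] := eqVneq p s; first by right; right.
have : uniq [:: p; q; r; s] by rewrite /= !inE !negb_or pq npr nps nqr nqs rs.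
by move/uniq_size_le; rewrite c3.
Qed.

(** A fifth element [e] could replace [d] by symmetry, relating [(c, d)] to [(c, e)]; so there are
    four elements, and [chain_card3] then excludes chains. *)
Lemma disjoint_caseI a b c d : uniq [:: a; b; c; d] -> same F a b c d -> caseI.
Proof.
move=> u h.
have [n4|n4] := eqVneq #|A| 4; last first.
  have [e eu] := exists_fresh u n4 (uniq_size_le u).
  have v : uniq [:: a; b; c; e].
    move: u eu; rewrite /= !inE !negb_or !andbT !(eq_sym e).
    by move=> /and3P[/and3P[-> -> _] /andP[-> _] _] /and4P[-> -> -> _].
  have [p [pa pb pc pd]] := uniq_perm_map u v erefl.
  have := same_perm symF p h; rewrite pa pb pc pd => h'.
  have w : uniq [:: c; d; e].
    move: u eu; rewrite /= !inE !negb_or !andbT !(eq_sym e).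
    by move=> /and3P[_ _ ->] /and4P[_ _ -> ->].
  by case: (not_shared w); apply: same_trans h'; apply: same_sym.
split=> // x y.
have mv p q r s : uniq [:: p; q; r; s] -> same F p q r s.
  move=> v; have [t [ta tb tc td]] := uniq_perm_map u v erefl.
  by have := same_perm symF t h; rewrite ta tb tc td.
have no3 p q r : uniq [:: p; q; r] -> ~ same F p q q r.
  by move=> v /(chain_card3 v); rewrite n4.
have tri (p q r : A) : p != q -> q != r -> p != r -> uniq [:: p; q; r].
  by rewrite /= !inE negb_or => -> -> ->.
(* A pair reaches its reversal through a pair on the complementary block. *)
have rev p q : p != q -> same F p q q p.
  move=> pq; have u2 : uniq [:: a; b] by move: u; rewrite /= !inE !negb_or => /andP[/andP[-> _] _].
  have v2 : uniq [:: p; q] by rewrite /= inE pq.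
  have [t [ta tb]] := uniq_perm_map u2 v2 erefl.
  have v4 : uniq [:: p; q; t c; t d].
    by rewrite -ta -tb -[X in uniq X]/(map t [:: a; b; c; d]) (map_inj_uniq perm_inj).
  apply: same_trans (mv _ _ _ _ v4) _; apply: mv.
  move: v4; rewrite /= !inE !negb_or !andbT (eq_sym (t c) q) (eq_sym (t c) p).
  rewrite (eq_sym (t d) q) (eq_sym (t d) p) (eq_sym q p).
  by move=> /and3P[/and3P[-> -> ->] /andP[-> ->] ->].
rewrite R2starP // /Rpm /ranp.
move: (x0 x) (x1 x) (x0 y) (x1 y) => p q r s.
split=> [[pq rs k]|[pq [rs k]]]; last first.
  split=> //; case: k => e.
    have := set21 r s; have := set22 r s; rewrite -e !inE.
    move=> /orP[] /eqP es /orP[] /eqP er; rewrite er es in rs *; rewrite ?eqxx // in rs.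
      exact: rev.
  apply: mv; rewrite /= !inE !negb_or pq rs /= !andbT.
  have := in_set0 p; have := in_set0 q; rewrite -e !inE !eqxx ?orbT /=.
  by move=> /negbT; rewrite negb_or => -> /negbT; rewrite negb_or => ->.
split=> //; split=> //.
have [epr|npr] := eqVneq p r.
  have [eqs|nqs] := eqVneq q s; first by left; rewrite epr eqs.
  by move: k; rewrite -epr => /not_shared []; apply: tri; rewrite // epr.
have [eqs|nqs] := eqVneq q s.
  by move: k; rewrite -eqs => /not_shared_r []; apply: tri => //; rewrite eq_sym // eqs.
have [eqr|nqr] := eqVneq q r; have [eps|nps] := eqVneq p s.
- by left; rewrite eqr eps setUC.
- by move: k; rewrite -eqr => /no3 []; apply: tri; rewrite // eqr.
- by move: k; rewrite eps => /same_sym /no3 []; apply: tri; rewrite // -?eps // eq_sym.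
right; apply/setP => z; rewrite !inE; apply/negbTE/negP.
by case/andP=> /orP[] /eqP -> /orP[] /eqP; apply/eqP.
Qed.

Lemma classification a b c d : a != b -> c != d -> same F a b c d ->
  [set a; b] = [set c; d] \/ caseI \/ caseII.
Proof.
move=> ab cd k.
have tri (p q r : A) : p != q -> q != r -> p != r -> uniq [:: p; q; r].
  by rewrite /= !inE negb_or => -> -> ->.
have [eac|nac] := eqVneq a c.
  have [ebd|nbd] := eqVneq b d; first by left; rewrite eac ebd.
  by move: k; rewrite -eac => /not_shared []; apply: tri; rewrite // eac.
have [ebd|nbd] := eqVneq b d.
  by move: k; rewrite -ebd => /not_shared_r []; apply: tri => //; rewrite eq_sym // ebd.
have [ebc|nbc] := eqVneq b c; have [ead|nad] := eqVneq a d.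
- by left; rewrite ebc ead setUC.
- right; right; move: k; rewrite -ebc; apply: chain_caseII; exact: tri.
- right; right; move: k; rewrite ead => /same_sym; apply: chain_caseII; by apply: tri => //; rewrite eq_sym.
right; left; apply: disjoint_caseI k; by rewrite /= !inE !negb_or ab nac nad nbc nbd cd.
Qed.

End Shared.

End Classification.

(** * The cyclic case *)

(* With the three elements written as the iterates nx^i c of a 3-cycle, [up3] and [dn3] are the
   operations [up] and [dn] below in terms of exponents. *)
Definition up3 i k := if k == i.+1 %% 3 then k else i.
Definition dn3 i k := if i == k.+1 %% 3 then k else i.
Definition all3 (P : pred nat) := [&& P 0, P 1 & P 2].
Definition has3 (P : pred nat) := [|| P 0, P 1 | P 2].

Lemma all3P (P : pred nat) : reflect (forall i, i < 3 -> P i) (all3 P).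
Proof.
apply: (iffP and3P) => [[p0 p1 p2] [|[|[|i]]]|h] //; by split; apply: h.
Qed.

Lemma has3P (P : pred nat) : reflect (exists2 i, i < 3 & P i) (has3 P).
Proof.
apply: (iffP or3P) => [[] p|[[|[|[|i]]]] // _ p].
- by exists 0.
- by exists 1.
- by exists 2.
- by constructor 1.
- by constructor 2.
- by constructor 3.
Qed.

(** An exhaustive check of the relations on a 3 x 3 grid. The origin is missing although its row and
    column are both met; the two outcomes, a cross and the graph of a rotation, are the shapes
    behind [pairs1] and [pairs0]. *)
Lemma invariant_grid (r : nat -> nat -> bool) :
  all3 (fun i => all3 (fun j => all3 (fun k => all3 (fun l =>
    r i j && r k l ==> r (up3 i k) (up3 j l) && r (dn3 i k) (dn3 j l))))) ->
  ~~ r 0 0 -> r 0 1 || r 0 2 -> r 1 0 || r 2 0 ->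
  has3 (fun a => has3 (fun b => all3 (fun i => all3 (fun j =>
    r i j ==> (i == a) || (j == b))))) ||
  has3 (fun k => all3 (fun i => all3 (fun j => r i j ==> (j == (i + k) %% 3)))).
Proof.
rewrite /all3 /has3 /up3 /dn3 /=.
by move: (r 0 0) (r 0 1) (r 0 2) (r 1 0) (r 1 1) (r 1 2) (r 2 0) (r 2 1) (r 2 2);
  do 9!case.
Qed.

Section Cyclic.
Variables (A : finType) (F : opset A).
Hypothesis cF : is_clone F.
Hypothesis consF : conservative F.
Hypothesis symF : symmetric_clone F.
Hypothesis II : caseII F.

Lemma cyclic_succ : exists nx : A -> A,
  [/\ forall x, nx x != x, forall x, nx (nx (nx x)) = x &
      forall x y, y != x -> y = nx x \/ y = nx (nx x)].
Proof.
have [c3 _] := II.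
have := cardT A; rewrite c3; case e : (enum A) (enum_uniq A) => [|a [|b [|c [|? ?]]]] // u _.
have v : uniq [:: b; c; a] by rewrite -(rot_uniq 2).
have [s [sa sb sc]] := uniq_perm_map u v erefl.
have full x : x \in [:: a; b; c] by rewrite -e mem_enum.
move: u; rewrite /= !inE negb_or !andbT => /andP[/andP[ab ac] bc].
exists s; split=> x; have := full x; rewrite !inE => /or3P[] /eqP ->;
  rewrite ?sa ?sb ?sc ?sa ?sb ?sc ?sa //; try by rewrite eq_sym.
- by move=> y; have := full y; rewrite !inE => /or3P[] /eqP ->; rewrite ?eqxx //; [left|right].
- by move=> y; have := full y; rewrite !inE => /or3P[] /eqP ->; rewrite ?eqxx //; [right|left].
- by move=> y; have := full y; rewrite !inE => /or3P[] /eqP ->; rewrite ?eqxx //; [left|right].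
Qed.

Section Succ.
Variable nx : A -> A.
Hypothesis nx_neq : forall x, nx x != x.
Hypothesis nx3 : forall x, nx (nx (nx x)) = x.
Hypothesis nx_cover : forall x y, y != x -> y = nx x \/ y = nx (nx x).

(** These are the two cyclic tournaments: of two distinct elements [up] takes the one that follows
    the other under [nx], and [dn] takes the other one. *)
Definition up x y := if y == nx x then y else x.
Definition dn x y := if x == nx y then y else x.

(** [R_up] preserves the orientation along the cycle, so the pairs [(x, nx x)] form a union of
    classes and [binary_interpolation] yields both tournaments. *)
Lemma same_succ a b c d : a != b -> c != d -> same F a b c d -> b = nx a -> d = nx c.
Proof.
move=> ab cd k e; have [_ /(_ (pr a b) (pr c d)) [h _]] := II.
have {h}: Rup (pr a b) (pr c d) by apply: h; apply/R2starP => //; rewrite !x0_pr !x1_pr.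
rewrite /Rup !x0_pr !x1_pr => -[_ [_ [h|[[bc ad]|[ad bc]]]]].
- by rewrite -(x1_pr c d) -h x1_pr e -[in RHS](x0_pr c d) -h x0_pr.
- have ec : c = nx a by rewrite -bc.
  case: (nx_cover (y := d) (x := a)) => [|ed|->]; rewrite 1?eq_sym //; last by rewrite ec.
  by rewrite ed ec eqxx in cd.
- rewrite -ad in cd *; case: (nx_cover cd) => [ec|->].
    by rewrite e ec eqxx in bc.
  by rewrite nx3.
Qed.

Lemma up_op : exists2 f, F f & forall x y, ap2 f x y = up x y.
Proof.
apply: (binary_interpolation cF consF symF (S := fun x y => y == nx x)).
by move=> a b c d ab cd k /eqP e; apply/eqP; apply: same_succ e.
Qed.

Lemma dn_op : exists2 f, F f & forall x y, ap2 f x y = dn x y.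
Proof.
apply: (binary_interpolation cF consF symF (S := fun x y => x == nx y)).
move=> a b c d ab cd /(same_rev cF consF ab cd) k /eqP e.
by apply/eqP; apply: same_succ k e; rewrite eq_sym.
Qed.

Lemma up_dn x y : x != y -> [/\ up x y = x, up y x = x, dn x y = y & dn y x = y] \/
  [/\ up x y = y, up y x = y, dn x y = x & dn y x = x].
Proof.
rewrite /up /dn => xy.
have nn z : (z == nx (nx z)) = false.
  by apply/negbTE/eqP => e; have := nx_neq (nx (nx z)); rewrite nx3 {1}e eqxx.
case: (nx_cover xy) => ->; first by left; rewrite nn eqxx.
by right; rewrite nx3 eqxx (negPf (nx_neq _)).
Qed.

Lemma upxx x : up x x = x. Proof. by rewrite /up; case: ifP. Qed.
Lemma dnxx x : dn x x = x. Proof. by rewrite /dn; case: ifP. Qed.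

(** On two elements [up] and [dn] act as join and meet of a two-element lattice, and this term is
    the lattice median. *)
Definition maj x y z := dn (dn (up x y) (up y z)) (up x z).

Lemma majP x y : [/\ maj x x y = x, maj x y x = x & maj y x x = x].
Proof.
rewrite /maj; have [->|xy] := eqVneq x y; first by rewrite !upxx !dnxx.
by case: (up_dn xy) => -[a b c d]; rewrite ?upxx ?a ?b ?dnxx ?c ?d ?dnxx ?c ?d.
Qed.

Section Relations.
Variables (Q : finType) (H : {set {ffun Q -> A}}).
Hypothesis H0 : H != set0.
Hypothesis invH : Inv F H.

Lemma closed_op2 (f : op A 2) h1 h2 : F f -> h1 \in H -> h2 \in H ->
  exists2 h : {ffun Q -> A}, h \in H & forall q, h q = ap2 f (h1 q) (h2 q).
Proof.
move=> Ff H1 H2; exists (Defs.pcomp f (fun i => if i == ord0 then h1 else h2)).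
  by apply: invH => // i; case: ifP.
by move=> q; rewrite ffunE; congr (f _); apply/ffunP => i; rewrite !ffunE; case: ifP.
Qed.

Lemma closed_up h1 h2 : h1 \in H -> h2 \in H ->
  exists2 h : {ffun Q -> A}, h \in H & forall q, h q = up (h1 q) (h2 q).
Proof.
move=> H1 H2; have [f Ff fE] := up_op; have [h hH hE] := closed_op2 Ff H1 H2.
by exists h => // q; rewrite hE fE.
Qed.

Lemma closed_dn h1 h2 : h1 \in H -> h2 \in H ->
  exists2 h : {ffun Q -> A}, h \in H & forall q, h q = dn (h1 q) (h2 q).
Proof.
move=> H1 H2; have [f Ff fE] := dn_op; have [h hH hE] := closed_op2 Ff H1 H2.
by exists h => // q; rewrite hE fE.
Qed.

Lemma closed_maj h1 h2 h3 : h1 \in H -> h2 \in H -> h3 \in H ->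
  exists2 h : {ffun Q -> A}, h \in H & forall q, h q = maj (h1 q) (h2 q) (h3 q).
Proof.
move=> H1 H2 H3.
have [a aH aE] := closed_up H1 H2; have [b bH bE] := closed_up H2 H3.
have [c cH cE] := closed_up H1 H3; have [d dH dE] := closed_dn aH bH.
by have [e eH eE] := closed_dn dH cH; exists e => // q; rewrite eE dE cE aE bE.
Qed.

(* Baker-Pixley for the majority operation [maj]. *)
Lemma two_decomposable (g : {ffun Q -> A}) :
  (forall p q, exists h : {ffun Q -> A}, [/\ h \in H, h p = g p & h q = g q]) -> g \in H.
Proof.
move=> h2.
suff ext m (l : seq Q) : size l < m ->
    exists2 h : {ffun Q -> A}, h \in H & forall q, q \in l -> h q = g q.
  have [h hH e] := ext _ (enum Q) (ltnSn _).
  by rewrite (_ : g = h) //; apply/ffunP => q; rewrite e // mem_enum.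
elim: m l => // m IH [|p [|q [|r l]]] /= lt.
- by have /set0Pn[h hH] := H0; exists h.
- by have [h [hH hp _]] := h2 p p; exists h => // q; rewrite inE => /eqP->.
- by have [h [hH hp hq]] := h2 p q; exists h => // z; rewrite !inE => /orP[] /eqP->.
(* Each of [a], [b], [c] omits one of the first three indices, so at every index of the list at
   least two of them agree with [g]. *)
have [|a aH aE] := IH [:: q, r & l]; first by [].
have [|b bH bE] := IH [:: p, r & l]; first by [].
have [|c cH cE] := IH [:: p, q & l]; first by [].
have [h hH hE] := closed_maj aH bH cH; exists h => // z; rewrite !inE hE.
case/or4P=> [/eqP->|/eqP->|/eqP->|zl].
- by rewrite bE ?cE ?inE ?eqxx ?orbT //; have [_ _ ->] := majP (g p) (a p).
- by rewrite aE ?cE ?inE ?eqxx ?orbT //; have [_ -> _] := majP (g q) (b q).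
- by rewrite aE ?bE ?inE ?eqxx ?orbT //; have [-> _ _] := majP (g r) (c r).
- by rewrite aE ?bE ?cE ?inE ?zl ?orbT //; have [-> _ _] := majP (g z) (g z).
Qed.

(** Values are counted from [c] at [p] and from [d] at [q], so the pair sought is the origin of the
    grid in [invariant_grid]. *)
Lemma binary_dichotomy (p q : Q) c d :
  (exists2 h : {ffun Q -> A}, h \in H & h p = c) ->
  (exists2 h : {ffun Q -> A}, h \in H & h q = d) ->
  [\/ exists h : {ffun Q -> A}, [/\ h \in H, h p = c & h q = d],
      exists s : {perm A}, forall h : {ffun Q -> A}, h \in H -> h q = s (h p) |
      exists a b : A, forall h : {ffun Q -> A}, h \in H -> h p = a \/ h q = b].
Proof.
move=> [hc cH hcE] [hd dH hdE].
have cov c0 x : exists2 i, i < 3 & x = iter i nx c0.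
  have [->|/nx_cover[]] := eqVneq x c0; first by exists 0.
    by exists 1.
  by exists 2.
pose r i j := [exists h in H, (h p == iter i nx c) && (h q == iter j nx d)].
have rP h : h \in H -> forall i j, h p = iter i nx c -> h q = iter j nx d -> r i j.
  by move=> hH i j e1 e2; apply/existsP; exists h; rewrite hH e1 e2 !eqxx.
case: (boolP (r 0 0)) => [/existsP[h /and3P[hH /eqP hp /eqP hq]]|r00].
  by constructor 1; exists h.
have nn z : (nx (nx z) == z) = false.
  by apply/negbTE/eqP => e; have := nx_neq (nx (nx z)); rewrite nx3 e eqxx.
have upE c0 i k : i < 3 -> k < 3 -> up (iter i nx c0) (iter k nx c0) = iter (up3 i k) nx c0.
  by case: i => [|[|[|//]]] _; case: k => [|[|[|//]]] _;
    rewrite /up /up3 /= ?nx3 ?eqxx ?nn 1?eq_sym ?nn ?(negPf (nx_neq _)) 1?eq_sym ?nn ?(negPf (nx_neq _)).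
have dnE c0 i k : i < 3 -> k < 3 -> dn (iter i nx c0) (iter k nx c0) = iter (dn3 i k) nx c0.
  by case: i => [|[|[|//]]] _; case: k => [|[|[|//]]] _;
    rewrite /dn /dn3 /= ?nx3 ?eqxx ?nn 1?eq_sym ?nn ?(negPf (nx_neq _)) 1?eq_sym ?nn ?(negPf (nx_neq _)).
have [||||] := @orP _ _ (@invariant_grid r _ r00 _ _).
- apply/all3P => i i3; apply/all3P => j j3; apply/all3P => k k3; apply/all3P => l l3.
  apply/implyP => /andP[/existsP[h1 /and3P[H1 /eqP p1 /eqP q1]] /existsP[h2 /and3P[H2 /eqP p2 /eqP q2]]].
  have [hu huH huE] := closed_up H1 H2; have [hv hvH hvE] := closed_dn H1 H2.
  by rewrite (rP hu) ?(rP hv) // ?huE ?hvE ?p1 ?p2 ?q1 ?q2 ?upE ?dnE.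
- have [j j3 e] := cov d (hc q); move: j j3 e (rP hc cH 0 j hcE e) => [|[|[|?]]] // _ _ rr.
  + by rewrite rr in r00.
  + by rewrite rr.
  + by rewrite rr orbT.
- have [j j3 e] := cov c (hd p); move: j j3 e (rP hd dH j 0 e hdE) => [|[|[|?]]] // _ _ rr.
  + by rewrite rr in r00.
  + by rewrite rr.
  + by rewrite rr orbT.
- move=> /has3P[a a3 /has3P[b b3 /all3P ab]]; constructor 3.
  exists (iter a nx c), (iter b nx d) => h hH.
  have [i i3 ei] := cov c (h p); have [j j3 ej] := cov d (h q).
  have /all3P/(_ j j3)/implyP/(_ (rP h hH i j ei ej)) := ab i i3.
  by rewrite ei ej => /orP[] /eqP->; [left|right].
move=> /has3P[k k3 /all3P rk]; constructor 2.
have u c0 : uniq [:: c0; nx c0; nx (nx c0)].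
  by rewrite /= !inE negb_or !(eq_sym c0) nx_neq nn /= eq_sym nx_neq.
have [s [s0 s1 s2]] := uniq_perm_map (u c) (u (iter k nx d)) erefl.
exists s => h hH.
have [i i3 ei] := cov c (h p); have [j j3 ej] := cov d (h q).
have /all3P/(_ j j3)/implyP/(_ (rP h hH i j ei ej))/eqP := rk i i3.
rewrite ei ej => ->.
case: i i3 {ei} => [|[|[|?]]] // _; rewrite /= ?s0 ?s1 ?s2;
  by case: k k3 {rk s0 s1 s2} => [|[|[|?]]] // _; rewrite /= ?nx3.
Qed.

End Relations.
End Succ.
End Cyclic.

(** * The Klein four-group *)

Section Klein.
Variable A : finType.
Hypothesis c4 : #|A| = 4.

Definition klein_set : {set {perm A}} :=
  [set s : {perm A} | (s == 1%g) || [forall x, (s x != x) && (s (s x) == x)]].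

Lemma klein_setP (s : {perm A}) : reflect (klein s) (s \in klein_set).
Proof.
rewrite inE; apply: (iffP orP) => [[/eqP->|/forallP h]|[->|[h1 h2]]].
- by left.
- by right; split=> x; have /andP[h1 /eqP h2] := h x.
- by left.
- by right; apply/forallP => x; rewrite h1 h2 eqxx.
Qed.

Lemma klein_inv s : s \in klein_set -> forall x, s (s x) = x.
Proof. by move=> /klein_setP[-> x|[_ h] x]; rewrite ?perm1. Qed.

Lemma klein_free s x : s \in klein_set -> s x = x -> s = 1%g.
Proof. by move=> /klein_setP[//|[h _] e]; have := h x; rewrite e eqxx. Qed.

Lemma fourth (x y z u v : A) : uniq [:: x; y; z] ->
  u \notin [:: x; y; z] -> v \notin [:: x; y; z] -> u = v.
Proof.
move=> w hu hv; apply/eqP/negPn/negP => uv.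
have : uniq [:: u, v, x, y & [:: z]].
  by rewrite cons_uniq in_cons negb_or uv hu cons_uniq hv.
by move/uniq_size_le; rewrite c4.
Qed.

(** A non-identity member exchanges [x] with its image and hence the two remaining points, so one
    value determines it. *)
Lemma klein_eq s t x : s \in klein_set -> t \in klein_set -> s x = t x -> s = t.
Proof.
move=> sK tK e.
have [s1|s1] := eqVneq (s x) x.
  by rewrite (klein_free sK s1) (klein_free (x := x) tK) // -e.
have ns y : s y != y by apply: contra s1 => /eqP /(klein_free sK) ->; rewrite perm1.
have nt y : t y != y.
  by rewrite e in s1; apply: contra s1 => /eqP /(klein_free tK) ->; rewrite perm1.
apply/permP => y.
have [->//|yx] := eqVneq y x; have [->|ysx] := eqVneq y (s x).
  by rewrite klein_inv // e klein_inv.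
apply: (@fourth x (s x) y).
- by rewrite /= !inE negb_or !(eq_sym x) s1 yx eq_sym ysx.
- rewrite !inE !negb_or ns (inj_eq perm_inj) yx !andbT.
  by apply: contra ysx => /eqP <-; rewrite klein_inv.
- rewrite !inE !negb_or nt e (inj_eq perm_inj) yx !andbT.
  by apply: contra ysx => /eqP; rewrite e => <-; rewrite klein_inv.
Qed.

(** Distinct non-identity members commute, since [t (s x)] and [s (t x)] both are the one point
    outside [x], [s x], [t x]; their product is thus an involution without fixed points. *)
Lemma klein_group_set : group_set klein_set.
Proof.
apply/group_setP; split=> [|s t sK tK]; first by rewrite inE eqxx.
have [-> |s1] := eqVneq s 1%g; first by rewrite mul1g.
have [-> |t1] := eqVneq t 1%g; first by rewrite mulg1.
have [<-|st] := eqVneq s t.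
  rewrite (_ : s * s = 1)%g; first by rewrite inE eqxx.
  by apply/permP => x; rewrite permM perm1 klein_inv.
have ns y : s y != y by apply: contra s1 => /eqP /(klein_free sK) ->.
have nt y : t y != y by apply: contra t1 => /eqP /(klein_free tK) ->.
have nst y : s y != t y by apply: contra st => /eqP /(klein_eq sK tK) ->.
have nf x : t (s x) != x by rewrite -[X in _ != X](klein_inv tK) (inj_eq perm_inj).
have comm x : t (s x) = s (t x).
  apply: (@fourth x (s x) (t x)).
  - by rewrite /= !inE negb_or !(eq_sym x) ns nt nst.
  - by rewrite !inE !negb_or nf nt (inj_eq perm_inj) ns.
  - by rewrite !inE !negb_or ns (inj_eq perm_inj) nt -[X in _ != X](klein_inv sK) (inj_eq perm_inj) eq_sym nst.
rewrite inE; apply/orP; right; apply/forallP => x; rewrite !permM nf /=.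
by rewrite [t (s x)]comm !klein_inv.
Qed.

Canonical klein_group := Group klein_group_set.

Lemma klein_trans x y : exists2 s, s \in klein_group & s x = y.
Proof.
have [->|xy] := eqVneq x y; first by exists 1%g; rewrite ?group1 // perm1.
have u2 : uniq [:: x; y] by rewrite /= inE xy.
have [||z zu] := exists_fresh u2; rewrite ?c4 //.
have u3 : uniq [:: z; x; y] by rewrite cons_uniq zu.
have [||w wu] := exists_fresh u3; rewrite ?c4 //.
have u4 : uniq [:: w; z; x; y] by rewrite cons_uniq wu.
have v4 : uniq [:: z; w; y; x].
  move: u4; rewrite /= !inE !negb_or !andbT (eq_sym z w) (eq_sym y x).
  by move=> /and3P[/and3P[-> -> ->] /andP[-> ->] ->].
have [s [sw sz sx sy]] := uniq_perm_map u4 v4 erefl.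
exists s => //; apply/klein_setP; right.
have full v : v \in [:: w; z; x; y] by apply: uniq_full u4 _; rewrite c4.
move: v4; rewrite /= !inE !negb_or => /and3P[/and3P[zw zy zx] /andP[wy wx] /andP[yx _]].
by split=> v; have := full v; rewrite !inE => /or4P[] /eqP ->;
  rewrite ?sw ?sz ?sx ?sy ?sw ?sz ?sx ?sy // eq_sym.
Qed.

End Klein.

(** * Local conditions *)

Section Restriction.
Variables (A Q : finType).
Implicit Types (H : {set {ffun Q -> A}}) (P : {set Q}).

Lemma mem_resset H P (g : {ffun Q -> A}) :
  res P g \in resset H P <-> exists2 h, h \in H & forall q, q \in P -> h q = g q.
Proof.
split=> [/imsetP[h hH e]|[h hH e]].
  exists h => // q qP; have := congr1 (fun u : {ffun subQ P -> A} => u (exist _ q qP)) e.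
  by rewrite !ffunE.
by apply/imsetP; exists h => //; apply/ffunP => -[q qP]; rewrite !ffunE /= e.
Qed.

Lemma res_pcomp P n (f : op A n) (hs : 'I_n -> {ffun Q -> A}) :
  res P (Defs.pcomp f hs) = Defs.pcomp f (fun i => res P (hs i)).
Proof.
by apply/ffunP => q; rewrite !ffunE; congr (f _); apply/ffunP => i; rewrite !ffunE.
Qed.

Lemma resset_lift H P n (hs : 'I_n -> {ffun subQ P -> A}) :
  (forall i, hs i \in resset H P) ->
  exists2 ks : 'I_n -> {ffun Q -> A}, forall i, ks i \in H & forall i, hs i = res P (ks i).
Proof.
move=> h; apply: (@fin_all_exists2 _ (fun=> {ffun Q -> A}) (fun _ k => k \in H)
  (fun i k => hs i = res P k)) => i.
by have /imsetP[k kH e] := h i; exists k.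
Qed.

Lemma Inv_res F H P : Inv F H -> Inv F (resset H P).
Proof.
move=> invH n f Ff hs /resset_lift[ks kH e].
have -> : Defs.pcomp f hs = res P (Defs.pcomp f ks).
  rewrite res_pcomp; apply/ffunP => q; rewrite !ffunE; congr (f _); apply/ffunP => i.
  by rewrite !ffunE e ffunE.
by apply/imset_f/invH.
Qed.

Lemma Inv_of_decomposable F H (fam : {set Q} -> Prop) : decomposable H fam ->
  (forall n (f : op A n) (hs : 'I_n -> {ffun Q -> A}) R, F n f -> (forall i, hs i \in H) ->
    fam R -> Defs.pcomp f (fun i => res R (hs i)) \in resset H R) -> Inv F H.
Proof.
move=> dec loc n f Ff hs hH; apply/dec => R famR.
by rewrite res_pcomp; apply: loc.
Qed.

Lemma decomposable_of_local H (fam : {set Q} -> Prop) :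
  (forall g : {ffun Q -> A},
    (forall R, fam R -> exists2 h : {ffun Q -> A}, h \in H & forall q, q \in R -> h q = g q) ->
    g \in H) -> decomposable H fam.
Proof.
move=> loc g; split=> [gH R _|h]; first exact: imset_f.
by apply: loc => R /h /mem_resset.
Qed.

(** Conservativity at a single index picks some [hs i] with the composed value there; on a pair of
    identified indices the same [hs i] works at both. *)
Lemma pcomp_local F H R n (f : op A n) (hs : 'I_n -> {ffun Q -> A}) :
  conservative F -> F n f -> (forall i, hs i \in H) ->
  (exists q, R = [set q]) \/ (exists p q, R = [set p; q] /\ forall h : {ffun Q -> A}, h \in H -> h p = h q) ->
  Defs.pcomp f (fun i => res R (hs i)) \in resset H R.
Proof.
move=> consF Ff hH sR; rewrite -res_pcomp; apply/mem_resset.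
case: sR => [[q ->]|[p [q [-> pq]]]]; have [i e] := consF _ f Ff [ffun i => hs i q];
  exists (hs i) => // z; rewrite !inE.
  by move=> /eqP->; rewrite ffunE e ffunE.
rewrite ffunE.
case/orP=> /eqP ->; last by rewrite e ffunE.
rewrite (_ : [ffun i => hs i p] = [ffun i => hs i q]) ?e ?ffunE ?pq //.
by apply/ffunP => j; rewrite !ffunE pq.
Qed.

End Restriction.

(** * Invariance criteria in the cyclic and the generic case *)

Section Main.
Variables (A Q : finType) (H : {set {ffun Q -> A}}) (F : opset A).
Hypothesis H0 : H != set0.
Hypothesis cF : is_clone F.
Hypothesis consF : conservative F.
Hypothesis symF : symmetric_clone F.
Hypothesis np : exists f, F f /\ ~ is_proj (n := 2) f.

(** Forward, [two_decomposable] reduces membership to pairs of indices, and by [binary_dichotomy] a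
    pair is realized directly or belongs to one of the two families. *)
Lemma part_cyclic : caseII F ->
  (Inv F H <->
     ((forall P, pairs0 H P \/ pairs1 H P -> Inv F (resset H P)) /\
      decomposable H (fun R => singles R \/ pairs0 H R \/ pairs1 H R))).
Proof.
move=> II; split=> [invH|[inv2 dec]]; last first.
  apply: (Inv_of_decomposable dec) => n f hs R Ff hH [sR|/inv2].
    by apply: (pcomp_local consF) => //; left.
  by apply=> // i; apply: imset_f.
split=> [P _|]; first exact: Inv_res.
apply: decomposable_of_local => g loc.
have [nx [nx1 nx3 nx_cover]] := cyclic_succ II.
apply: (two_decomposable cF consF symF II nx1 nx3 nx_cover H0 invH) => p q.
have hp z : exists2 h, h \in H & h z = g z.
  have [|h hH e] := loc [set z]; first by left; exists z.
  by exists h => //; apply: e; rewrite inE.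
have [<-|pq] := eqVneq p q; first by have [h hH e] := hp p; exists h.
have hpq : pairs0 H [set p; q] \/ pairs1 H [set p; q] ->
    exists h, [/\ h \in H, h p = g p & h q = g q].
  move=> k; have [|h hH e] := loc [set p; q]; first by right.
  by exists h; split=> //; apply: e; rewrite !inE eqxx ?orbT.
have [//|s01|s01] := binary_dichotomy cF consF symF II nx1 nx3 nx_cover invH (hp p) (hp q).
  by apply: hpq; left; exists p, q.
by apply: hpq; right; exists p, q.
Qed.

Lemma part_generic : ~ caseI F -> ~ caseII F ->
  (Inv F H <->
     ((forall B : {set A}, #|B| = 2 -> InvB B F (resset H (QB H B))) /\
      decomposable H (fun R => singles R \/ pairsid H R \/
                               exists B : {set A}, #|B| = 2 /\ R = QB H B))).
Proof.
move=> nI nII.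
have QBv B h q : h \in H -> q \in QB H B -> h q \in B.
  by move=> hH; rewrite inE => /subsetP; apply; apply: imset_f.
split=> [invH|[invB dec]]; last first.
  apply: (Inv_of_decomposable dec) => n f hs R Ff hH [sR|[[p [q [_ [-> pq]]]]|[B [cB ->]]]].
  - by apply: (pcomp_local consF) => //; left.
  - by apply: (pcomp_local consF) => //; right; exists p, q.
  apply: (proj2 (invB B cB)) => // [i|i q]; first exact: imset_f.
  by rewrite ffunE; apply: QBv => //; apply: (valP q).
split=> [B cB|].
  split=> [k /imsetP[h hH ->] q|n f Ff hs hH _]; last exact: (Inv_res invH Ff hH).
  by rewrite ffunE; apply: QBv => //; apply: (valP q).
apply: decomposable_of_local => g loc.
(* [J] collects the local witnesses on the sets [QB H B]; for sets not of size two its value is an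
   arbitrary member of [H]. *)
have [J JP] : exists J : {set A} -> {ffun Q -> A}, forall B, J B \in H /\
    (#|B| = 2 -> forall q, q \in QB H B -> J B q = g q).
  apply: (@fin_all_exists {set A} (fun=> {ffun Q -> A}) (fun B (h : {ffun Q -> A}) => h \in H /\
    (#|B| = 2 -> forall q, q \in QB H B -> h q = g q))) => B.
  have [cB|nB] := eqVneq #|B| 2.
    have [|h hH e] := loc (QB H B); first by right; right; exists B.
    by exists h.
  by have /set0Pn[h hH] := H0; exists h; split=> // cB; rewrite cB in nB.
pose G := [1 {perm A}]%G.
have G1 s : s \in G -> s = 1%g by rewrite inE => /eqP.
apply: (@mem_of_local _ G _ _ _ F cF consF symF _ _ H g J invH).
- by move=> s /G1 -> x; rewrite !perm1.
- by move=> s x /G1.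
- by left.
- move=> a b x y ab xy k; have [e|[]] // := classification cF consF symF np ab xy k.
  have := set21 x y; have := set22 x y; rewrite -e !inE.
  move=> /orP[] /eqP ey /orP[] /eqP ex; rewrite ex ey ?eqxx // in xy *.
    by rewrite orb_swap orb_self.
  exact: orb_self.
- by move=> B; have [] := JP B.
- by move=> a b q ab; apply: (proj2 (JP _)); rewrite cards2 ab.
- by move=> s a b /G1 ->; rewrite !perm1.
- move=> q; have [|h hH e] := loc [set q]; first by left; exists q.
  by exists h => //; apply: e; rewrite inE.
move=> p q s /G1 -> k; rewrite perm1.
have [->//|pq] := eqVneq p q.
have [|h hH e] := loc [set p; q].
  by right; left; exists p, q; split=> //; split=> // h /k; rewrite perm1.
by rewrite -!e ?inE ?eqxx ?orbT // k // perm1.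
Qed.

End Main.

(** * The invariance criterion in the Klein case *)

Section KleinCase.
Variables (A Q : finType) (H : {set {ffun Q -> A}}) (F : opset A).
Hypothesis H0 : H != set0.
Hypothesis cF : is_clone F.
Hypothesis consF : conservative F.
Hypothesis symF : symmetric_clone F.
Hypothesis cI : caseI F.

Let c4 : #|A| = 4 := proj1 cI.
Let G := klein_group c4.

Lemma fresh_elt (a : A) : exists b, a != b.
Proof.
have [||b] := @exists_fresh A [:: a] isT; rewrite ?c4 //.
by rewrite inE eq_sym; exists b.
Qed.

Lemma same_Rpm a b x y : a != b -> x != y ->
  (same F a b x y <-> [set a; b] = [set x; y] \/ [set a; b] :&: [set x; y] = set0).
Proof.
move=> ab xy; have := proj2 cI (pr a b) (pr x y).
rewrite R2starP // /Rpm /ranp !x0_pr !x1_pr => -[h1 h2]; split=> k.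
  by have [_ []] := h1 (And3 ab xy k).
by have [] := h2 (conj ab (conj xy k)).
Qed.

Lemma same_klein s a b : s \in G -> a != b -> same F a b (s a) (s b).
Proof.
move=> sG ab; apply/same_Rpm => //; first by rewrite (inj_eq perm_inj).
have [->|s1] := eqVneq s 1%g; first by left; rewrite !perm1.
have ns x : s x != x by apply: contra s1 => /eqP /(klein_free sG) ->.
have [sab|sab] := eqVneq (s a) b; first by left; rewrite -{1 2}sab klein_inv // setUC sab.
right; apply/setP => z; rewrite !inE; apply/negbTE/negP.
case/andP=> /orP[] /eqP -> /orP[]; apply/negP; rewrite eq_sym //.
by apply: contra sab => /eqP <-; rewrite klein_inv.
Qed.

(** For disjoint blocks, the Klein permutation taking [a] to [x] must take [b] to the only point
    left, which is [y]. *)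
Lemma same_orb_klein a b x y : a != b -> x != y -> same F a b x y -> orb G a b x y.
Proof.
move=> ab xy /(same_Rpm ab xy) [e|e].
  have := set21 x y; have := set22 x y; rewrite -e !inE.
  move=> /orP[] /eqP ey /orP[] /eqP ex; rewrite ex ey ?eqxx // in xy *.
    by rewrite orb_swap orb_self.
  exact: orb_self.
have [s sG sax] := klein_trans c4 a x.
have := in_set0 a; have := in_set0 b; rewrite -e !inE !eqxx ?orbT /=.
move=> /negbT; rewrite negb_or => /andP[bx by_] /negbT; rewrite negb_or => /andP[ax ay].
have s1 : s != 1%g by apply: contra ax => /eqP s1; rewrite -sax s1 perm1.
have ns z : s z != z by apply: contra s1 => /eqP /(klein_free sG) ->.
have u : uniq [:: a; b; x] by rewrite /= !inE negb_or ab ax bx.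
apply/existsP; exists s; rewrite sG -sax eqxx /= (_ : y = s b) ?eqxx //.
apply: (fourth c4 u).
  by rewrite !inE !negb_or !(eq_sym y) ay by_ xy.
rewrite !inE !negb_or ns -sax (inj_eq perm_inj) [b == a]eq_sym ab !andbT.
by apply: contra bx => /eqP e'; rewrite -sax -e' klein_inv.
Qed.

Lemma card_image2 n (a b : A) (t : {ffun 'I_n -> A}) i j : within a b t -> t i != t j ->
  #|[set t k | k : 'I_n]| = 2.
Proof.
move=> w ij; have -> : [set t k | k : 'I_n] = [set t i; t j]; last by rewrite cards2 ij.
apply/setP => x; apply/imsetP/idP => [[k _ ->]|].
  by rewrite -(set2_eq ij (w i) (w j)); apply: w.
by rewrite !inE => /orP[] /eqP ->; [exists i|exists j].
Qed.

Lemma klein_fun_mem n (f : op A n) : F f -> klein_fun (Pi0 F) f.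
Proof.
move=> Ff; split=> [b0 b1 b01|a /eqP/cards2P[x [y [xy e]]] s /klein_setP sG].
  split=> [a ab|]; first by have [i ->] := consF Ff a.
  by left; exists f; split=> //; exists b0, b1.
apply/esym/(eqv2_mem cF consF same_klein Ff sG xy) => i.
by rewrite -e; apply: imset_f.
Qed.

(** The block witnessing [Pi0] may differ from {a, b}; conjugation by a permutation taking [a] to
    [b0] and [b] to [b1] brings the operation back inside [F]. *)
Lemma Pi0_realized n (f : op A n) a b : a != b ->
  (forall t : {ffun 'I_n -> A}, within a b t -> f t \in [set a; b]) ->
  Pi0 F (conj_op a b f) -> exists2 g, F g & forall t, within a b t -> g t = f t.
Proof.
move=> ab fab [f' [Ff' [b0 [b1 [b01 e]]]]].
have u : uniq [:: a; b] by rewrite /= inE ab.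
have v : uniq [:: b0; b1] by rewrite /= inE b01.
have [s [sa sb]] := uniq_perm_map u v erefl.
exists [ffun t : {ffun 'I_n -> A} => (s^-1)%g (f' [ffun i => s (t i)])]; first exact: symF.
move=> t w; rewrite ffunE; apply: (@perm_inj _ s); rewrite permKV.
have := congr1 (fun h : bop n => h [ffun i => t i == b]) e; rewrite /= !ffunE.
have -> : [ffun i => if [ffun i => t i == b] i then b else a] = t.
  apply/ffunP => i; rewrite !ffunE; have := w i; rewrite !inE.
  by case: (t i =P b) => [->//|_]; rewrite orbF => /eqP.
have -> : [ffun i => if [ffun i => t i == b] i then b1 else b0] = [ffun i => s (t i)].
  apply/ffunP => i; rewrite !ffunE; have := w i; rewrite !inE.
  by case: (t i =P b) => [->//|_]; rewrite orbF => /eqP ->.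
have [j ej] := consF Ff' [ffun i => s (t i)].
have : f' [ffun i => s (t i)] \in [set b0; b1].
  by rewrite ej ffunE; have := w j; rewrite !inE => /orP[] /eqP ->; rewrite ?sa ?sb eqxx ?orbT.
have := fab t w; rewrite !inE => /orP[] /eqP -> /orP[] /eqP ->; rewrite ?sa ?sb //.
  by rewrite eqxx (negPf ab).
by rewrite eqxx (negPf b01).
Qed.

(** On each block [Pi0_realized] supplies a member agreeing with [f], and the Klein condition is the
    equivariance by which [block_patching] glues these members. *)
Lemma klein_fun_realized n (f : op A n) : klein_fun (Pi0 F) f ->
  exists f0, F f0 /\ forall a b t, a != b -> within a b t -> f0 t = f t.
Proof.
move=> [f1 f2].
have locf a b : a != b -> exists2 g, F g & forall t, within a b t -> g t = f t.
  move=> ab; have [f3 [|f4]] := f1 a b ab; first exact: Pi0_realized.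
  have [||g Fg gE] := Pi0_realized _ _ f4; first by rewrite eq_sym.
    by move=> t w; rewrite setUC; apply: f3 => i; rewrite setUC; apply: w.
  by exists g => // t w; apply: gE => i; rewrite setUC; apply: w.
have fcons a b t : a != b -> within a b t -> exists i, f t = t i.
  by move=> ab w; have [g Fg gE] := locf a b ab; rewrite -gE //; apply: consF.
have two : exists a b : A, a != b.
  have [||a _] := @exists_fresh A [::] isT; rewrite ?c4 //.
  by have [b ab] := fresh_elt a; exists a, b.
apply: (block_patching (klein_inv (A := A)) (klein_free (A := A)) cF consF symF
  same_klein same_orb_klein) => // s sG a b t ab w.
(* The Klein condition concerns tuples with exactly two values; on constant tuples equivariance
   follows from conservativity on blocks. *)
have [[i [j ij]]|cst] := classic (exists i j, t i != t j).
  by rewrite (f2 t (card_image2 w ij)) //; apply/klein_setP.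
have cst' i j : t i = t j.
  by apply/eqP/negPn/negP => h; apply: cst; exists i, j.
have [i ->] := fcons a b t ab w.
have [||k ->] := fcons (s a) (s b) (tact s t); first by rewrite (inj_eq perm_inj).
  by move=> k; have := w k; rewrite ffunE !inE !(inj_eq perm_inj).
by rewrite ffunE (cst' k i).
Qed.

Lemma Q3P q : q \in Q3 H -> exists a b, a != b /\ Hq H q \subset [set a; b].
Proof.
have /set0Pn[h hH] := H0.
have hq : h q \in Hq H q by apply: imset_f.
rewrite inE ltnS leq_eqVlt => /orP[/cards2P[a [b [ab ->]]]|].
  by exists a, b.
rewrite ltnS => le1; have [b ab] := fresh_elt (h q); exists (h q), b; split=> //.
apply/subsetP => x xH; rewrite !inE.
by rewrite (card_le1_eqP le1 x (h q)) ?eqxx.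
Qed.

Lemma part_klein :
  (Inv F H <->
     ((forall P, pairs0 H P -> Inv F (resset H P)) /\
      (forall n (f : op A n), klein_fun (Pi0 F) f -> preserves f (resset H (Q3 H))) /\
      decomposable H (fun R => singles R \/ pairs0 H R \/ R = Q3 H))).
Proof.
split=> [invH|[inv0 [inv3 dec]]]; last first.
  apply: (Inv_of_decomposable dec) => n f hs R Ff hH [sR|[p0|->]].
  - by apply: (pcomp_local consF) => //; left.
  - by apply: inv0 => // i; apply: imset_f.
  by apply: inv3 => [|i]; [apply: klein_fun_mem | apply: imset_f].
split=> [P _|]; first exact: Inv_res.
split=> [n f kf hs /resset_lift[ks kH e]|].
  have [f0 [Ff0 f0E]] := klein_fun_realized kf.
  have -> : Defs.pcomp f hs = res (Q3 H) (Defs.pcomp f0 ks).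
    apply/ffunP => -[q q3]; rewrite !ffunE /=.
    have [a [b [ab /subsetP sub]]] := Q3P q3.
    rewrite (f0E a b) => // [|i]; last by rewrite ffunE; apply/sub/imset_f.
    by congr (f _); apply/ffunP => i; rewrite !ffunE e ffunE.
  by apply/imset_f/invH.
apply: decomposable_of_local => g loc.
(* One member [h3] agreeing with [g] on all of [Q3 H] serves every block at once, so the constant
   choice of [J] is invariant under [G]. *)
have [|h3 h3H h3E] := loc (Q3 H); first by right; right.
apply: (@mem_of_local _ G (klein_inv (A := A)) (klein_free (A := A)) _ F cF consF symF
  same_orb_klein Q H g (fun=> h3) invH) => //.
- by right; apply: klein_trans.
- move=> a b q ab; rewrite inE => sub; apply: h3E; rewrite inE.
  by apply: leq_ltn_trans (subset_leq_card sub) _; rewrite cards2 ab.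
- move=> q; have [|h hH e] := loc [set q]; first by left; exists q.
  by exists h => //; apply: e; rewrite inE.
move=> p q s sG k.
have [epq|pq] := eqVneq p q.
  rewrite -epq in k *; have [|h hH e] := loc [set p]; first by left; exists p.
  by rewrite -(e p) ?inE ?eqxx //; apply: k.
have [|h hH e] := loc [set p; q].
  by right; left; exists p, q; split=> //; split=> //; exists s.
by rewrite -!e ?inE ?eqxx ?orbT // k.
Qed.

End KleinCase.

Theorem theorem4 (A Q : finType) (H : {set {ffun Q -> A}}) (F : opset A) :
  2 <= #|A| -> 0 < #|Q| -> H != set0 ->
  is_clone F -> conservative F -> symmetric_clone F -> r_is F 2 ->
  let caseI := #|A| = 4 /\ (forall x y, R2star F x y <-> Rpm x y) in
  let caseII := #|A| = 3 /\ (forall x y, R2star F x y <-> Rup x y) in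
  (* (4) *)
  (~ caseI -> ~ caseII ->
     (Inv F H <->
        ((forall B : {set A}, #|B| = 2 -> InvB B F (resset H (QB H B))) /\
         decomposable H (fun R => singles R \/ pairsid H R \/
                                  exists B : {set A}, #|B| = 2 /\ R = QB H B)))) /\
  (* (5) *)
  (caseI ->
     (Inv F H <->
        ((forall P, pairs0 H P -> Inv F (resset H P)) /\
         (forall n (f : op A n), klein_fun (Pi0 F) f -> preserves f (resset H (Q3 H))) /\
         decomposable H (fun R => singles R \/ pairs0 H R \/ R = Q3 H)))) /\
  (* (6) *)
  (caseII ->
     (Inv F H <->
        ((forall P, pairs0 H P \/ pairs1 H P -> Inv F (resset H P)) /\
         decomposable H (fun R => singles R \/ pairs0 H R \/ pairs1 H R)))).
Proof.
move=> _ _ H0 cF consF symF [np _] cI cII; split; first exact: part_generic.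
by split=> [hI|hII]; [apply: part_klein | apply: part_cyclic].
Qed.
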